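(* Let $1\le M\le L$, let $\mu_1,\dots,\mu_M,\nu_1,\dots,\nu_M\in\Lambda$ be arbitrary, and assume $b_-(\xi_i,\xi_j)\ne0$ for all $i\ne j$ in $\{1,\dots,L\}$. Then the scalar product $$\mathcal S(\{\mu\},\{\nu\})=\langle1|B_{1\dots L}(\mu_1)\cdots B_{1\dots L}(\mu_M)\,C_{1\dots L}(\nu_M)\cdots C_{1\dots L}(\nu_1)|1\rangle$$ is given by $$\mathcal S(\{\mu\},\{\nu\})=\sum_{1\le l_1<\dots<l_M\le L}\ \prod_{m=1}^M\ \prod_{\substack{p=1\\ p\ne l_1,\dots,l_M}}^L\frac{a_-(\mu_m,\xi_p)\,a_-(\nu_m,\xi_p)}{b_-(\xi_p,\xi_{l_m})\,a_-(\xi_{l_m},\xi_p)}\;Z^{(C)}_M(\{\nu\},\{\xi_l\})\,Z^{(B)}_M(\{\mu\},\{\xi_l\}),$$ and, explicitly, $$\mathcal S(\{\mu\},\{\nu\})=\sum_{1\le l_1<\dots<l_M\le L}\ \sum_{\sigma,\tau\in S_M}\ \prod_{m=1}^M\prod_{\substack{p=1\\ p\ne l_1,\dots,l_M}}^L\frac{a_-(\mu_m,\xi_p)a_-(\nu_m,\xi_p)}{b_-(\xi_p,\xi_{l_m})a_-(\xi_{l_m},\xi_p)}\ \prod_{i=1}^Mc_-(\nu_i,\xi_{l_{\sigma_i}})c_+(\mu_i,\xi_{l_{\tau_i}})$$ $$\times\prod_{1\le j<k\le M}\frac{\theta(\xi_{l_{\sigma_k}},\xi_{l_{\sigma_j}})}{\theta(\xi_{l_{\tau_j}},\xi_{l_{\tau_k}})}\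 \frac{b_-(\nu_k,\xi_{l_{\sigma_j}})\,b_-(\mu_k,\xi_{l_{\tau_j}})\,a_-(\nu_j,\xi_{l_{\sigma_k}})\,a_-(\mu_j,\xi_{l_{\tau_k}})}{b_-(\xi_{l_{\sigma_k}},\xi_{l_{\sigma_j}})\,b_-(\xi_{l_{\tau_k}},\xi_{l_{\tau_j}})}.$$
   Context: Weights. Let $\Lambda$ be a set and $a_-,b_\pm,c_\pm:\Lambda\times\Lambda\to\mathbb C$ functions. Let $R(\lambda_1,\lambda_2)\in\mathrm{End}(\mathbb C^2\otimes\mathbb C^2)$ be, in the ordered basis $(e_1\otimes e_1,e_1\otimes e_2,e_2\otimes e_1,e_2\otimes e_2)$, $$R=\begin{pmatrix}1&0&0&0\\ 0&b_+&c_+&0\\ 0&c_-&b_-&0\\ 0&0&0&a_-\end{pmatrix}(\lambda_1,\lambda_2).$$ For labelled copies $V_i\cong\mathbb C^2$, $R_{ij}(\lambda,\lambda')$ denotes $R(\lambda,\lambda')$ acting on $V_i\otimes V_j$ (first tensor factor $=V_i$, second $=V_j$) and trivially elsewhere. Standing assumptions, for all $\lambda_i\in\Lambda$: unitarity $R_{12}(\lambda_1,\lambda_2)R_{21}(\lambda_2,\lambda_1)=I$, and the Yang-Baxter equation $R_{12}(\lambda_1,\lambda_2)R_{13}(\lambda_1,\lambda_3)R_{23}(\lambda_2,\lambda_3)=R_{23}(\lambda_2,\lambda_3)R_{13}(\lambda_1,\lambda_3)R_{12}(\lambda_1,\lambda_2)$. (Unitarity gives $a_-(\lambda,\lambda')a_-(\lambda',\lambda)=1$.)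 Fix $\xi_1,\dots,\xi_L\in\Lambda$, $\xi_i$ attached to $V_i$. For $1\le l_1<\dots<l_M\le L$ and an auxiliary space $V_a\cong\mathbb C^2$, put $R_{a l_M}(\mu,\xi_{l_M})\cdots R_{a l_1}(\mu,\xi_{l_1})=\begin{pmatrix}A_{l_1\dots l_M}(\mu)&B_{l_1\dots l_M}(\mu)\\ C_{l_1\dots l_M}(\mu)&D_{l_1\dots l_M}(\mu)\end{pmatrix}_a$ (a $2\times 2$ matrix in $V_a$ with entries in $\mathrm{End}(V_{l_1}\otimes\dots\otimes V_{l_M})$); $B_{1\dots L}$, $C_{1\dots L}$ are the case of all labels $1,\dots,L$. Reference states: on a tensor product of spaces $V_i$, $|0\rangle=\bigotimes_i e_1$, $|1\rangle=\bigotimes_i e_2$, and $\langle0|$, $\langle1|$ are their transposes. Domain wall partition functions: $Z^{(B)}_M(\{\mu\},\{\xi_l\})=\langle1|B_{l_1\dots l_M}(\mu_1)\cdots B_{l_1\dots l_M}(\mu_M)|0\rangle$ and $Z^{(C)}_M(\{\nu\},\{\xi_l\})=\langle0|C_{l_1\dots l_M}(\nu_M)\cdots C_{l_1\dots l_M}(\nu_1)|1\rangle$, with reference states on $V_{l_1}\otimes\dots\otimes V_{l_M}$. The function $\theta$ depends on the order of the indices: $\theta(\xi_i,\xi_j)=a_-(\xi_i,\xi_j)$ if $i<j$ and $\theta(\xi_i,\xi_j)=1$ if $i\ge j$. For $\sigma\in S_M$, $\sigma_i=\sigma(i)$. *)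

(* Defs.v *)
From mathcomp Require Import all_boot all_order all_fingroup all_algebra.

Set Implicit Arguments.
Unset Strict Implicit.
Unset Printing Implicit Defensive.

Import GRing.Theory.
Local Open Scope ring_scope.

(* The basis vectors e_1, e_2 of C^2 are indexed by 'I_2. *)
Notation e1 := (ord0 : 'I_2).
Notation e2 := (ord_max : 'I_2).

(* Product basis of the tensor product of copies of C^2 labelled by the finite
   type I: the configuration s stands for the tensor of the e_(s i), i in I.
   Matrices over 'I_#|{: conf I}| represent linear maps in this basis, the
   configurations being numbered by enum_rank, with inverse enum_val. *)
Notation conf I := {ffun I -> 'I_2}.
Notation tensor_dim I := #|{: conf I}|.
Notation op_on F I := 'M[F]_(tensor_dim I).

Section SixVertex.

Variable F : fieldType.

Definition rank_of (I : finType) (s : conf I) : 'I_(tensor_dim I) := enum_rank s.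
Definition conf_of (I : finType) (r : 'I_(tensor_dim I)) : conf I := enum_val r.

(* Position of e_a (x) e_b in (e1 (x) e1, e1 (x) e2, e2 (x) e1, e2 (x) e2). *)
Definition pair_index (a b : 'I_2) : 'I_4 := inord (2 * a + b).

Definition six_vertex_R (Lam : Type) (am bp bm cp cm : Lam -> Lam -> F)
    (x y : Lam) : 'M[F]_4 :=
  \matrix_(i < 4, j < 4)
    nth 0 (nth [::] [:: [:: 1; 0;      0;      0     ];
                        [:: 0; bp x y; cp x y; 0     ];
                        [:: 0; cm x y; bm x y; 0     ];
                        [:: 0; 0;      0;      am x y]] i) j.

(* X acting on V_i (x) V_j, with V_i as the first factor, and trivially on the
   other spaces; only meant for i != j. *)
Definition act2 (I : finType) (X : 'M[F]_4) (i j : I) : op_on F I :=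
  \matrix_(r, c)
    let s := conf_of r in let t := conf_of c in
    X (pair_index (s i) (s j)) (pair_index (t i) (t j))
    * [forall k, (k != i) && (k != j) ==> (s k == t k)]%:R.

Section Rmatrix.

Variables (Lam : Type) (Rm : Lam -> Lam -> 'M[F]_4).

Definition unitarity : Prop :=
  forall x1 x2 : Lam,
    act2 (Rm x1 x2) (0 : 'I_2) 1 * act2 (Rm x2 x1) (1 : 'I_2) 0 = 1.

Definition yang_baxter : Prop :=
  forall x1 x2 x3 : Lam,
    let V1 : 'I_3 := inord 0 in
    let V2 : 'I_3 := inord 1 in
    let V3 : 'I_3 := inord 2 in
    act2 (Rm x1 x2) V1 V2 * act2 (Rm x1 x3) V1 V3 * act2 (Rm x2 x3) V2 V3
    = act2 (Rm x2 x3) V2 V3 * act2 (Rm x1 x3) V1 V3 * act2 (Rm x1 x2) V1 V2.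

(* Below, N spaces are labelled by 'I_N and x i is attached to the i-th one; the
   operators with labels l_1 < ... < l_M are the case N = M, x = xi \o l.
   The auxiliary space V_a has the label None in option 'I_N. *)

(* R_{a N} ... R_{a 1}: \prod multiplies from left to right. *)
Definition monodromy (N : nat) (x : 'I_N -> Lam) (mu : Lam)
    : op_on F (option 'I_N) :=
  \prod_(i < N) act2 (Rm mu (x (rev_ord i))) None (Some (rev_ord i)).

Definition with_aux (N : nat) (a : 'I_2) (s : conf 'I_N) : conf (option 'I_N) :=
  [ffun o => if o is Some i then s i else a].

(* The (a, b) entry of T as a 2 x 2 matrix in the auxiliary space. *)
Definition aux_block (N : nat) (T : op_on F (option 'I_N)) (a b : 'I_2)
    : op_on F 'I_N :=
  \matrix_(r, c)
    T (rank_of (with_aux a (conf_of r))) (rank_of (with_aux b (conf_of c))).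

Definition opB (N : nat) (x : 'I_N -> Lam) (mu : Lam) : op_on F 'I_N :=
  aux_block (monodromy x mu) e1 e2.

Definition opC (N : nat) (x : 'I_N -> Lam) (mu : Lam) : op_on F 'I_N :=
  aux_block (monodromy x mu) e2 e1.

(* The reference states: ket e1 = |0>, ket e2 = |1>, and their transposes. *)
Definition ket (N : nat) (a : 'I_2) : 'cV[F]_(tensor_dim 'I_N) :=
  delta_mx (rank_of [ffun => a]) 0.

Definition bra (N : nat) (a : 'I_2) : 'rV[F]_(tensor_dim 'I_N) := (ket N a)^T.

(* <a| O |b>; row times column is a 1 x 1 matrix. *)
Definition expectation (N : nat) (a : 'I_2) (O : op_on F 'I_N) (b : 'I_2) : F :=
  (bra N a *m O *m ket N b) 0 0.

Definition ZB (M : nat) (mu : 'I_M -> Lam) (x : 'I_M -> Lam) : F :=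
  expectation e2 (\prod_(i < M) opB x (mu i)) e1.

Definition ZC (M : nat) (nu : 'I_M -> Lam) (x : 'I_M -> Lam) : F :=
  expectation e1 (\prod_(i < M) opC x (nu (rev_ord i))) e2.

Definition scalar_product (L M : nat) (xi : 'I_L -> Lam) (mu nu : 'I_M -> Lam)
    : F :=
  expectation e2
    ((\prod_(i < M) opB xi (mu i)) * (\prod_(i < M) opC xi (nu (rev_ord i)))) e2.

End Rmatrix.

(* theta(xi_i, xi_j); it depends on the positions i, j, not only on the values
   of xi there. *)
Definition theta (Lam : Type) (am : Lam -> Lam -> F) (L : nat)
    (xi : 'I_L -> Lam) (i j : 'I_L) : F :=
  if (i < j)%N then am (xi i) (xi j) else 1.

End SixVertex.

Definition increasing (M L : nat) (l : {ffun 'I_M -> 'I_L}) : bool :=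
  [forall i : 'I_M, forall j : 'I_M, (i < j)%N ==> (l i < l j)%N].

(* Main.v *)
(** The vector C(nu)|1> has an expansion over single flipped sites in which the
    site i has first been carried to the front of the chain by the operators
    R_{p i}(xi_p, xi_i); its coefficients are c_-(nu, xi_i) times products of
    ratios a_-/b_-, by a partial fraction identity that follows from two
    components of the Yang-Baxter equation.  Since the R_{p i} intertwine the
    monodromy matrices of differently ordered chains, the next operators C see
    site i at the front, where it only contributes a factor b_-, so the
    expansion iterates and C(nu_M)...C(nu_1)|1> becomes a sum over injective
    choices of M sites.  Paired with <0|, this is the explicit formula for Z^(C).
    Paired with <1|B(mu_1)...B(mu_M), the chosen sites l have been moved in front
    of the others, where B(mu_1)...B(mu_M) reduces to the operators B_l, and
    summing over the orders of the chosen sites leaves Z^(C) Z^(B).  Transposition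
    exchanges B with C and c_+ with c_- and reverses the chain; it gives Z^(B). *)
Require Import Defs.
From mathcomp Require Import all_boot all_order all_fingroup all_algebra.
From mathcomp Require Import complex reals.
From mathcomp Require Import ring.

Set Implicit Arguments.
Unset Strict Implicit.
Unset Printing Implicit Defensive.

Import GRing.Theory.
Local Open Scope ring_scope.
Local Open Scope complex_scope.

(** * Operators acting on one or two tensor factors, in the product basis *)

Lemma sum_I2 (V : nmodType) (f : 'I_2 -> V) : \sum_(a < 2) f a = f e1 + f e2.
Proof. by rewrite big_ord_recr big_ord1; congr (f _ + _); apply: val_inj. Qed.

Lemma I2P (a : 'I_2) : (a = e1) + (a = e2).
Proof. by case: a => [[|[|//]] ?]; [left | right]; apply: val_inj. Qed.

Section Tensor.

Variables (F : fieldType) (I : finType).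
Implicit Types (s t : conf I) (i j k : I).

(* upd is opaque: comparing nested updates by unfolding is exponential. *)
Fact upd_subproof : {f : conf I -> I -> 'I_2 -> conf I |
  forall s i a k, f s i a k = if k == i then a else s k}.
Proof.
exists (fun s i a => [ffun k => if k == i then a else s k]) => *.
by rewrite ffunE.
Qed.

Definition upd := sval upd_subproof.

Lemma updE s i a k : upd s i a k = if k == i then a else s k.
Proof. exact: (svalP upd_subproof). Qed.

Lemma upd_id s i : upd s i (s i) = s.
Proof. by apply/ffunP=> k; rewrite updE; case: eqP => // ->. Qed.

Lemma upd_upd s i a b : upd (upd s i a) i b = upd s i b.
Proof. by apply/ffunP=> k; rewrite !updE; case: eqP. Qed.

Lemma updC s i j a b : i != j -> upd (upd s i a) j b = upd (upd s j b) i a.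
Proof.
move=> ij; apply/ffunP=> k; rewrite !updE.
by case: (k =P i) => // ->; rewrite (negPf ij).
Qed.

Lemma upd_same s i a : upd s i a i = a.
Proof. by rewrite updE eqxx. Qed.

Lemma upd_other s i j a : j != i -> upd s i a j = s j.
Proof. by rewrite updE => /negPf ->. Qed.

Lemma conf_of_rank s : conf_of (rank_of s) = s.
Proof. exact: enum_rankK. Qed.

Lemma eq_entries n (A B : 'M[F]_(tensor_dim I, n)) :
  (forall s c, A (rank_of s) c = B (rank_of s) c) -> A = B.
Proof.
by move=> AB; apply/matrixP=> r c; rewrite -(enum_valK r); apply: AB.
Qed.

Lemma sum_conf (f : 'I_(tensor_dim I) -> F) :
  \sum_r f r = \sum_(s : conf I) f (rank_of s).
Proof.
rewrite (reindex (@rank_of I)) //.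
by exists (@conf_of I) => y _; [apply: enum_rankK | apply: enum_valK].
Qed.

(** The indicator in [act2] kills every configuration that differs from [s] away from [i] and [j],
    so the sum over all configurations collapses to a sum over the two new entries. *)
Lemma act2_mulE (X : 'M[F]_4) i j n (A : 'M[F]_(tensor_dim I, n)) s c :
  i != j ->
  (act2 X i j *m A) (rank_of s) c =
  \sum_a \sum_b X (pair_index (s i) (s j)) (pair_index a b)
                * A (rank_of (upd (upd s i a) j b)) c.
Proof.
move=> ij; rewrite mxE sum_conf.
under eq_bigr => t _ do rewrite mxE !conf_of_rank.
rewrite pair_big /=.
pose h (ab : 'I_2 * 'I_2) := upd (upd s i ab.1) j ab.2.
rewrite (bigID (fun t => [forall k, (k != i) && (k != j) ==> (s k == t k)])) /=.
rewrite [X in _ + X]big1 ?addr0; last first.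
  by move=> t /negPf ->; rewrite mulr0 mul0r.
rewrite (reindex_onto h (fun t => (t i, t j))) /=; last first.
  move=> t /forallP st; apply/ffunP=> k; rewrite !updE.
  case: eqP => [-> //|/eqP kj]; case: eqP => [-> //|/eqP ki].
  by have := st k; rewrite ki kj /= => /eqP.
apply: eq_big => [[a b]|[a b] _] /=.
  rewrite /h /= upd_same upd_other // upd_same eqxx andbT.
  by apply/forallP=> k; apply/implyP => /andP[ki kj]; rewrite !upd_other.
rewrite /h /= upd_same upd_other // upd_same.
case: forallP => [_|[]]; first by rewrite mulr1.
by move=> k; apply/implyP => /andP[ki kj]; rewrite !upd_other.
Qed.

Lemma trmx_act2 (X : 'M[F]_4) i j : (act2 X i j)^T = act2 X^T i j.
Proof.
apply/matrixP=> r c; rewrite !mxE /= ?mxE.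
by under eq_forallb => k do rewrite (eq_sym (conf_of c k)).
Qed.

(** One-site analogue of [act2]; the auxiliary-space entries of a single R-matrix have this form. *)
Definition site_op (Y : 'I_2 -> 'I_2 -> F) i : op_on F I :=
  \matrix_(r, c) (Y (conf_of r i) (conf_of c i)
    * [forall k, (k != i) ==> (conf_of r k == conf_of c k)]%:R).

Lemma site_op_mulE Y i n (A : 'M[F]_(tensor_dim I, n)) s c :
  (site_op Y i *m A) (rank_of s) c =
  \sum_a Y (s i) a * A (rank_of (upd s i a)) c.
Proof.
rewrite mxE sum_conf.
under eq_bigr => t _ do rewrite mxE !conf_of_rank.
rewrite (bigID (fun t => [forall k, (k != i) ==> (s k == t k)])) /=.
rewrite [X in _ + X]big1 ?addr0; last first.
  by move=> t /negPf ->; rewrite mulr0 mul0r.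
rewrite (reindex_onto (upd s i) (fun t => t i)) /=; last first.
  move=> t /forallP st; apply/ffunP=> k; rewrite !updE.
  case: eqP => [-> //|/eqP ki].
  by have := st k; rewrite ki /= => /eqP.
apply: eq_big => [a|a _] /=.
  rewrite upd_same eqxx andbT.
  by apply/forallP=> k; apply/implyP => ki; rewrite !upd_other.
rewrite upd_same.
case: forallP => [_|[]]; first by rewrite mulr1.
by move=> k; apply/implyP => ki; rewrite !upd_other.
Qed.

Lemma trmx_site_op Y i : (site_op Y i)^T = site_op (fun a b => Y b a) i.
Proof.
apply/matrixP=> r c; rewrite !mxE /= ?mxE.
by under eq_forallb => k do rewrite (eq_sym (conf_of c k)).
Qed.

Lemma eq_site_op Y Y' i :
  (forall a b, Y a b = Y' a b) -> site_op Y i = site_op Y' i.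
Proof. by move=> YY'; apply/matrixP=> r c; rewrite !mxE YY'. Qed.

Lemma site_op_comm Y Z i j : i != j ->
  site_op Y i *m site_op Z j = site_op Z j *m site_op Y i.
Proof.
(* Appending an identity gives the right-hand factor a matrix to act on, so that [site_op_mulE]
   evaluates both factors. *)
move=> ij; rewrite -[LHS]mulmx1 -[RHS]mulmx1 -!mulmxA.
apply: eq_entries => s c; rewrite !site_op_mulE.
under eq_bigr => a _.
  rewrite site_op_mulE upd_other 1?eq_sym // mulr_sumr.
  under eq_bigr => b _ do rewrite mulrCA updC //.
over.
rewrite exchange_big /=; apply: eq_bigr => b _.
by rewrite site_op_mulE upd_other // mulr_sumr.
Qed.

Lemma site_op_act2_comm Y X i j k : i != j -> k != i -> k != j ->
  site_op Y k *m act2 X i j = act2 X i j *m site_op Y k.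
Proof.
move=> ij ki kj; rewrite -[LHS]mulmx1 -[RHS]mulmx1 -!mulmxA.
apply: eq_entries => s c; rewrite site_op_mulE act2_mulE //.
under eq_bigr => a _.
  rewrite act2_mulE // !(@upd_other s k) 1?[_ == k]eq_sym // mulr_sumr.
  under eq_bigr => b _.
    rewrite mulr_sumr.
    under eq_bigr => d _ do rewrite mulrCA (updC _ _ _ ki) (updC _ _ _ kj).
  over.
over.
rewrite exchange_big /=; apply: eq_bigr => b _.
rewrite exchange_big /=; apply: eq_bigr => d _.
by rewrite site_op_mulE !upd_other // mulr_sumr.
Qed.

Definition ket_conf t : 'cV[F]_(tensor_dim I) := delta_mx (rank_of t) 0.

Lemma ket_confE t s c : ket_conf t (rank_of s) c = (s == t)%:R.
Proof. by rewrite mxE ord1 eqxx andbT /rank_of (inj_eq enum_rank_inj). Qed.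

End Tensor.

(** * The six-vertex weights and the scalar relations drawn from unitarity and Yang-Baxter *)

Section Weights.

Variables (F : fieldType) (Lam : Type).
Variables (am bp bm cp cm : Lam -> Lam -> F).

Local Notation Rm := (six_vertex_R am bp bm cp cm).

(** The first pair of indices is outgoing (the row), the second incoming (the column). *)
Definition weight (y z : Lam) (a b a' b' : 'I_2) : F :=
  Rm y z (pair_index a b) (pair_index a' b').

Lemma weightE y z :
  ((weight y z e1 e1 e1 e1 = 1) * (weight y z e1 e1 e1 e2 = 0)
  * (weight y z e1 e1 e2 e1 = 0) * (weight y z e1 e1 e2 e2 = 0))
  * ((weight y z e1 e2 e1 e1 = 0) * (weight y z e1 e2 e1 e2 = bp y z)
  * (weight y z e1 e2 e2 e1 = cp y z) * (weight y z e1 e2 e2 e2 = 0))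
  * ((weight y z e2 e1 e1 e1 = 0) * (weight y z e2 e1 e1 e2 = cm y z)
  * (weight y z e2 e1 e2 e1 = bm y z) * (weight y z e2 e1 e2 e2 = 0))
  * ((weight y z e2 e2 e1 e1 = 0) * (weight y z e2 e2 e1 e2 = 0)
  * (weight y z e2 e2 e2 e1 = 0) * (weight y z e2 e2 e2 e2 = am y z)).
Proof. by do ![split]; rewrite /weight mxE /pair_index !inordK. Qed.

Lemma trmx_six_vertex y z : (Rm y z)^T = six_vertex_R am bp bm cm cp y z.
Proof.
apply/matrixP=> i j; rewrite !mxE.
by case: i j => [[|[|[|[|//]]]] ?] [[|[|[|[|//]]]] ?].
Qed.

(** Both sides of the Yang-Baxter equation are applied to a vector [G] and read at one component. In
    this form the equation applies to three factors of any larger tensor product, and an indicator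
    [G] extracts a scalar relation. *)
Lemma yang_baxter_weights (YB : yang_baxter Rm) y1 y2 y3
    (G : 'I_2 -> 'I_2 -> 'I_2 -> F) a b c :
  \sum_a1 \sum_b1 weight y1 y2 a b a1 b1 *
    (\sum_a2 \sum_c1 weight y1 y3 a1 c a2 c1 *
      (\sum_b2 \sum_c2 weight y2 y3 b1 c1 b2 c2 * G a2 b2 c2))
  = \sum_b1 \sum_c1 weight y2 y3 b c b1 c1 *
    (\sum_a1 \sum_c2 weight y1 y3 a c1 a1 c2 *
      (\sum_a2 \sum_b2 weight y1 y2 a1 b1 a2 b2 * G a2 b2 c2)).
Proof.
have := YB y1 y2 y3; set V1 : 'I_3 := inord 0; set V2 : 'I_3 := inord 1.
set V3 : 'I_3 := inord 2 => /= YB123.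
have V12 : V1 != V2 by rewrite -val_eqE /= !inordK.
have V13 : V1 != V3 by rewrite -val_eqE /= !inordK.
have V23 : V2 != V3 by rewrite -val_eqE /= !inordK.
clearbody V1 V2 V3.
pose A : 'cV[F]_(tensor_dim 'I_3) :=
  \col_r G (conf_of r V1) (conf_of r V2) (conf_of r V3).
have AE t : A (rank_of t) 0 = G (t V1) (t V2) (t V3).
  by rewrite mxE conf_of_rank.
clearbody A.
pose s : conf 'I_3 :=
  [ffun k => if k == V1 then a else if k == V2 then b else c].
have sV1 : s V1 = a by rewrite ffunE eqxx.
have sV2 : s V2 = b by rewrite ffunE eq_sym (negPf V12) eqxx.
have sV3 : s V3 = c by rewrite ffunE eq_sym (negPf V13) eq_sym (negPf V23).
clearbody s.
have V21 : V2 != V1 by rewrite eq_sym.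
have V31 : V3 != V1 by rewrite eq_sym.
have V32 : V3 != V2 by rewrite eq_sym.
have updVE := (updE, negPf V12, negPf V13, negPf V23, negPf V21, negPf V31,
  negPf V32, eqxx).
transitivity ((act2 (Rm y1 y2) V1 V2 *m act2 (Rm y1 y3) V1 V3
               *m act2 (Rm y2 y3) V2 V3 *m A) (rank_of s) 0).
  rewrite -!mulmxA act2_mulE // sV1 sV2.
  apply: eq_bigr => a1 _; apply: eq_bigr => b1 _; congr (_ * _).
  rewrite act2_mulE // !updVE sV3.
  apply: eq_bigr => a2 _; apply: eq_bigr => c1 _; congr (_ * _).
  rewrite act2_mulE // !updVE.
  apply: eq_bigr => b2 _; apply: eq_bigr => c2 _; congr (_ * _).
  by rewrite AE !updVE.
rewrite !mulmxE YB123 -!mulmxE -!mulmxA act2_mulE // sV2 sV3.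
apply: eq_bigr => b1 _; apply: eq_bigr => c1 _; congr (_ * _).
rewrite act2_mulE // !updVE sV1.
apply: eq_bigr => a1 _; apply: eq_bigr => c2 _; congr (_ * _).
rewrite act2_mulE // !updVE.
apply: eq_bigr => a2 _; apply: eq_bigr => b2 _; congr (_ * _).
by rewrite AE !updVE.
Qed.

(** The inner weight has its legs exchanged because the second factor of unitarity is R_{21}. *)
Lemma unitarity_weights (U : unitarity Rm) y z a b (G : 'I_2 -> 'I_2 -> F) :
  \sum_a1 \sum_b1 weight y z a b a1 b1 *
    (\sum_b2 \sum_a2 weight z y b1 a1 b2 a2 * G a2 b2) = G a b.
Proof.
have V01 : (0 : 'I_2) != 1 by [].
have V10 : (1 : 'I_2) != 0 by [].
have updVE := (updE, negPf V01, negPf V10, eqxx).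
pose A : 'cV[F]_(tensor_dim 'I_2) := \col_r G (conf_of r 0) (conf_of r 1).
have AE t : A (rank_of t) 0 = G (t 0) (t 1) by rewrite mxE conf_of_rank.
clearbody A.
pose s : conf 'I_2 := [ffun k => if k == 0 then a else b].
have := congr1 (fun B => (B *m A) (rank_of s) 0) (U y z).
rewrite /= -!mulmxE -idmxE mul1mx AE !ffunE /= -!mulmxA act2_mulE // !ffunE.
move=> <-; apply: eq_bigr => a1 _; apply: eq_bigr => b1 _; congr (_ * _).
rewrite act2_mulE // !updVE; apply: eq_bigr => b2 _; apply: eq_bigr => a2 _.
by rewrite AE !updVE.
Qed.

Lemma am_inv (U : unitarity Rm) y z : am y z * am z y = 1.
Proof.
have := unitarity_weights U y z e2 e2 (fun _ _ => 1).
by rewrite !sum_I2 !weightE !(mul0r, mulr0, addr0, add0r, mulr1).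
Qed.

(** An off-diagonal entry of unitarity, whence a vanishing sum and the sign. *)
Lemma cm_bm_unitarity (U : unitarity Rm) y z :
  bm y z * cp z y = - (cm y z * bm z y).
Proof.
have := unitarity_weights U y z e2 e1 (fun a b => ((a == e1) && (b == e2))%:R).
rewrite !sum_I2 !weightE /= !(mul0r, mulr0, addr0, add0r, mulr1).
by move/addr0_eq <-.
Qed.

(** The Yang-Baxter entry with column [e1 e2 e2] and row [e2 e2 e1]; it supplies the relation
    between [h] and [f] in [cm_prod_bp]. *)
Lemma cm_bp_yang_baxter (YB : yang_baxter Rm) y1 y2 y3 :
  am y2 y3 * am y1 y2 * cm y1 y3 =
  bm y2 y3 * bp y1 y2 * cm y1 y3 + cm y1 y2 * am y1 y3 * cm y2 y3.
Proof.
have := yang_baxter_weights YB y1 y2 y3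
  (fun a b c => ((a == e1) && (b == e2) && (c == e2))%:R) e2 e2 e1.
rewrite !sum_I2 !weightE /= !(mul0r, mulr0, addr0, add0r, mulr1) => h.
by ring: h.
Qed.

(** The entry with column [e2 e1 e2] and row [e2 e2 e1]; it supplies the relation between [g] and
    [k] in [cm_prod_bp]. *)
Lemma cm_bm_yang_baxter (YB : yang_baxter Rm) y1 y2 y3 :
  cm y2 y3 * bm y1 y3 * am y1 y2 =
  bm y1 y2 * am y1 y3 * cm y2 y3 + cp y1 y2 * cm y1 y3 * bm y2 y3.
Proof.
have := yang_baxter_weights YB y1 y2 y3
  (fun a b c => ((a == e2) && (b == e1) && (c == e2))%:R) e2 e2 e1.
rewrite !sum_I2 !weightE /= !(mul0r, mulr0, addr0, add0r, mulr1) => h.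
by ring: h.
Qed.

End Weights.

(** * Entries of the monodromy matrix for an arbitrary order of the sites *)

Section Blocks.

Variables (F : fieldType) (Lam : Type).
Variables (am bp bm cp cm : Lam -> Lam -> F) (N : nat) (x : 'I_N -> Lam).

Local Notation Rm := (six_vertex_R am bp bm cp cm).
Local Notation weight := (weight am bp bm cp cm).
Implicit Types (i p : 'I_N) (q u w : seq 'I_N) (s t : conf 'I_N).

Definition site_block i (mu : Lam) (a b : 'I_2) : op_on F 'I_N :=
  site_op (fun c c' => weight mu (x i) a c b c') i.

(* The head of q is the leftmost factor of the monodromy: it acts last. *)
Fixpoint chain_block q (mu : Lam) (a b : 'I_2) : op_on F 'I_N :=
  if q is i :: q' then
    \sum_c site_block i mu a c *m chain_block q' mu c b
  else (a == b)%:R%:M.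

(** No sites are permuted: this is R_{p i}, which intertwines the chains where [p] and [i] are
    adjacent in either order. *)
Definition swap_op p i : op_on F 'I_N := act2 (Rm (x p) (x i)) p i.

Lemma aux_block_act2 i mu (A : op_on F (option 'I_N)) a b :
  aux_block (act2 (Rm mu (x i)) None (Some i) * A) a b =
  \sum_c site_block i mu a c *m aux_block A c b.
Proof.
apply: eq_entries => s r; rewrite summxE [LHS]mxE conf_of_rank -mulmxE.
rewrite act2_mulE //.
apply: eq_bigr => c _; rewrite site_op_mulE !ffunE.
apply: eq_bigr => b' _; congr (_ * _); rewrite [RHS]mxE conf_of_rank.
congr (A (rank_of _) _).
by apply/ffunP => -[j|]; rewrite !(updE, ffunE) /= ?updE.
Qed.

Lemma aux_block_prod q mu a b :
  aux_block (\prod_(i <- q) act2 (Rm mu (x i)) None (Some i)) a b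
  = chain_block q mu a b.
Proof.
elim: q a b => [|i q IHq] a b.
  rewrite big_nil -idmxE; apply: eq_entries => s r; rewrite -(enum_valK r) /=.
  set t := enum_val r; rewrite mxE /conf_of /rank_of !enum_rankK !mxE.
  rewrite !(inj_eq enum_rank_inj).
  have -> : (with_aux a s == with_aux b t) = (a == b) && (s == t).
    apply/eqP/andP => [/ffunP st|[/eqP-> /eqP->] //].
    split; first by have := st None; rewrite !ffunE => ->.
    by apply/eqP/ffunP => k; have := st (Some k); rewrite !ffunE.
  by case: eqP; case: eqP => _ _ /=; rewrite ?mulr1n ?mul0rn.
rewrite big_cons aux_block_act2 /=.
by apply: eq_bigr => c _; rewrite IHq.
Qed.

Lemma aux_block_monodromy mu a b :
  aux_block (monodromy Rm x mu) a b = chain_block (rev (enum 'I_N)) mu a b.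
Proof.
rewrite -aux_block_prod; apply: (congr1 (fun T => aux_block T a b)).
rewrite /monodromy.
have -> : rev (enum 'I_N) = [seq rev_ord i | i <- enum 'I_N].
  apply: (inj_map val_inj); rewrite map_rev val_enum_ord.
  apply: (@eq_from_nth _ 0%N) => [|k]; rewrite size_rev size_iota.
    by rewrite size_map size_map size_enum_ord.
  move=> kN; rewrite nth_rev size_iota // nth_iota ?add0n; last first.
    by rewrite ltn_subrL (leq_trans _ kN).
  rewrite (nth_map (Ordinal kN)) ;last first.
    by rewrite size_map size_enum_ord.
  by rewrite (nth_map (Ordinal kN)) ?size_enum_ord //= nth_enum_ord.
by rewrite big_map enumT.
Qed.

Lemma chain_block_cat q1 q2 mu a b :
  chain_block (q1 ++ q2) mu a b =
  \sum_c chain_block q1 mu a c *m chain_block q2 mu c b.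
Proof.
elim: q1 a => [|i q1 IH] a /=.
  rewrite (bigD1 a) //= eqxx mul1mx big1 ?addr0 // => c.
  by rewrite eq_sym => /negPf ->; rewrite mul_scalar_mx scale0r.
under eq_bigr => c _ do rewrite IH mulmx_sumr.
rewrite exchange_big /=; apply: eq_bigr => c _.
by rewrite mulmx_suml; apply: eq_bigr => d _; rewrite mulmxA.
Qed.

Lemma site_op_chain_comm Y p q mu a b : p \notin q ->
  site_op Y p *m chain_block q mu a b = chain_block q mu a b *m site_op Y p.
Proof.
elim: q a => [|i q IH] a /=; first by rewrite scalar_mxC.
rewrite inE negb_or => /andP[pi pq].
rewrite mulmx_sumr mulmx_suml; apply: eq_bigr => c _.
by rewrite mulmxA site_op_comm // -!mulmxA IH.
Qed.

Lemma chain_comm q1 q2 mu nu a b c d : ~~ has (mem q2) q1 ->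
  chain_block q1 mu a b *m chain_block q2 nu c d =
  chain_block q2 nu c d *m chain_block q1 mu a b.
Proof.
elim: q1 a => [|i q1 IH] a /=; first by rewrite scalar_mxC.
rewrite negb_or => /andP[iq2 q12].
rewrite mulmx_sumr mulmx_suml; apply: eq_bigr => e _.
by rewrite -mulmxA IH // !mulmxA site_op_chain_comm.
Qed.

Lemma swap_chain_comm p i q mu a b : p != i -> p \notin q -> i \notin q ->
  swap_op p i *m chain_block q mu a b = chain_block q mu a b *m swap_op p i.
Proof.
move=> pi; elim: q a => [|j q IH] a /=; first by rewrite scalar_mxC.
rewrite !inE !negb_or => /andP[pj pq] /andP[ij iq].
rewrite mulmx_sumr mulmx_suml; apply: eq_bigr => c _.
have jp : j != p by rewrite eq_sym.
have ji : j != i by rewrite eq_sym.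
by rewrite mulmxA -site_op_act2_comm // -!mulmxA IH.
Qed.

Hypothesis YB : yang_baxter Rm.

(** The Yang-Baxter equation with the auxiliary space as first leg and [p], [i] as second and third,
    read at one auxiliary entry. *)
Lemma site_block_exchange p i mu a e : p != i ->
  \sum_d site_block p mu a d *m (site_block i mu d e *m swap_op p i) =
  swap_op p i *m \sum_d site_block i mu a d *m site_block p mu d e.
Proof.
move=> pi; rewrite -[LHS]mulmx1 -[RHS]mulmx1.
apply: eq_entries => s r; rewrite mulmx_suml summxE.
pose A : op_on F 'I_N := 1%:M.
(* [G] pins the incoming auxiliary index to [e] and reads a column of the identity on the sites. *)
pose G a2 b2 c2 := (a2 == e)%:R * A (rank_of (upd (upd s p b2) i c2)) r.
have GE (f : 'I_2 -> F) b2 c2 : \sum_a2 f a2 * G a2 b2 c2 =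
    f e * A (rank_of (upd (upd s p b2) i c2)) r.
  rewrite (bigD1 e) //= /G eqxx mul1r big1 ?addr0 // => a2 /negPf ->.
  by rewrite mul0r mulr0.
have ip : i != p by rewrite eq_sym.
transitivity (\sum_a1 \sum_b1 weight mu (x p) a (s p) a1 b1 *
    (\sum_a2 \sum_c1 weight mu (x i) a1 (s i) a2 c1 *
      (\sum_b2 \sum_c2 weight (x p) (x i) b1 c1 b2 c2 * G a2 b2 c2))).
  apply: eq_bigr => d _; rewrite -!mulmxA site_op_mulE.
  apply: eq_bigr => b1 _; congr (_ * _); rewrite site_op_mulE exchange_big /=.
  apply: eq_bigr => c1 _; rewrite upd_other //.
  rewrite (bigD1 e) //= [X in _ + X]big1 ?addr0; last first.
    move=> a2 /negPf ae; rewrite big1 ?mulr0 // => b2 _.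
    rewrite big1 // => c2 _.
    by rewrite /G ae mul0r mulr0.
  congr (_ * _); rewrite act2_mulE // upd_same upd_other // upd_same.
  apply: eq_bigr => b2 _; apply: eq_bigr => c2 _; rewrite /G eqxx mul1r.
  by congr (_ * A (rank_of _) _); rewrite (updC _ _ _ ip) upd_upd upd_upd.
rewrite yang_baxter_weights // -mulmxA act2_mulE //.
apply: eq_bigr => b1 _; apply: eq_bigr => c1 _; congr (_ * _).
rewrite mulmx_suml summxE; apply: eq_bigr => d _; rewrite -mulmxA site_op_mulE.
apply: eq_bigr => c2 _; rewrite upd_same; congr (_ * _).
rewrite exchange_big /= site_op_mulE upd_other // upd_other // upd_same.
apply: eq_bigr => b2 _; rewrite GE; congr (_ * A (rank_of _) _).
by rewrite upd_upd (updC _ _ _ ip) upd_upd.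
Qed.

(** The swap commutes leftwards through [w], exchanges the two adjacent sites by
    [site_block_exchange], and commutes out through [u]. *)
Lemma chain_exchange u p i w mu a b : uniq (u ++ p :: i :: w) ->
  chain_block (u ++ p :: i :: w) mu a b *m swap_op p i =
  swap_op p i *m chain_block (u ++ i :: p :: w) mu a b.
Proof.
elim: u a => [|j u IH] a /=.
  rewrite inE negb_or => /and3P[/andP[pi pw] iw _].
  transitivity (\sum_d (\sum_c site_block p mu a c *m
     (site_block i mu c d *m swap_op p i)) *m chain_block w mu d b).
    under [RHS]eq_bigr => d _ do rewrite mulmx_suml.
    rewrite exchange_big mulmx_suml; apply: eq_bigr => c _ /=.
    rewrite mulmx_sumr mulmx_suml; apply: eq_bigr => d _.
    by rewrite -!mulmxA swap_chain_comm.
  transitivity (\sum_d swap_op p i *m ((\sum_c site_block i mu a c *m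
     site_block p mu c d) *m chain_block w mu d b)).
    apply: eq_bigr => d _; rewrite mulmxA; congr (_ *m _).
    exact: site_block_exchange.
  rewrite -mulmx_sumr; congr (_ *m _).
  under [LHS]eq_bigr => d _ do rewrite mulmx_suml.
  rewrite exchange_big; apply: eq_bigr => c _ /=.
  by rewrite mulmx_sumr; apply: eq_bigr => d _; rewrite mulmxA.
rewrite mem_cat !inE !negb_or => /andP[/and4P[_ jp ji _] upiw].
rewrite mulmx_sumr mulmx_suml; apply: eq_bigr => c _.
rewrite -mulmxA IH // !mulmxA; congr (_ *m _).
apply: site_op_act2_comm => //.
move: upiw; rewrite cat_uniq => /and3P[_ _ /andP[]].
by rewrite inE negb_or => /andP[].
Qed.

End Blocks.

(** * Local operators applied to basis kets *)

Section TensorKets.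

Variables (F : fieldType) (I : finType).
Implicit Types (s t : conf I) (i j k : I).

Lemma site_op_ket (Y : 'I_2 -> 'I_2 -> F) i t :
  site_op Y i *m ket_conf F t = \sum_a Y a (t i) *: ket_conf F (upd t i a).
Proof.
apply: eq_entries => s c; rewrite site_op_mulE summxE.
rewrite (bigD1 (t i)) //= big1 ?addr0; last first.
  move=> a ati; rewrite ket_confE; case: eqP => [st|]; last by rewrite mulr0.
  by rewrite -st upd_same eqxx in ati.
rewrite [RHS](bigD1 (s i)) //= [X in _ = _ + X]big1 ?addr0; last first.
  move=> a asi; rewrite mxE ket_confE; case: eqP => [st|]; last by rewrite mulr0.
  by rewrite st upd_same eqxx in asi.
rewrite [RHS]mxE !ket_confE; congr (_ * (nat_of_bool _)%:R).
apply/eqP/eqP => [<-|->]; first by rewrite upd_upd upd_id.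
by rewrite upd_upd upd_id.
Qed.

Lemma act2_ket (X : 'M[F]_4) i j t : i != j ->
  act2 X i j *m ket_conf F t = \sum_a \sum_b
    X (pair_index a b) (pair_index (t i) (t j))
      *: ket_conf F (upd (upd t i a) j b).
Proof.
move=> ij; have ji : j != i by rewrite eq_sym.
apply: eq_entries => s c; rewrite act2_mulE // !summxE.
rewrite (bigD1 (t i)) //= [X in _ + X]big1 ?addr0; last first.
  move=> a ati; rewrite big1 // => b _.
  rewrite ket_confE; case: eqP => [st|]; last by rewrite mulr0.
  by rewrite -st upd_other // upd_same eqxx in ati.
rewrite (bigD1 (t j)) //= big1 ?addr0; last first.
  move=> b btj.
  rewrite ket_confE; case: eqP => [st|]; last by rewrite mulr0.
  by rewrite -st upd_same eqxx in btj.
rewrite [RHS](bigD1 (s i)) //= [X in _ = _ + X]big1 ?addr0; last first.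
  move=> a asi; rewrite summxE big1 // => b _.
  rewrite mxE ket_confE; case: eqP => [st|]; last by rewrite mulr0.
  by rewrite st upd_other // upd_same eqxx in asi.
rewrite summxE [RHS](bigD1 (s j)) //= [X in _ = _ + X]big1 ?addr0; last first.
  move=> b bsj; rewrite mxE ket_confE; case: eqP => [st|]; last by rewrite mulr0.
  by rewrite st upd_same eqxx in bsj.
rewrite [RHS]mxE !ket_confE; congr (_ * (nat_of_bool _)%:R).
apply/eqP/eqP => [<-|->].
  by rewrite (updC _ _ _ ij) upd_upd (updC _ _ _ ji) upd_upd upd_id upd_id.
by rewrite (updC _ _ _ ij) upd_upd (updC _ _ _ ji) upd_upd upd_id upd_id.
Qed.

End TensorKets.

(* The partial fraction identity behind the expansion of C(nu)|1>; taking
   h = k _ r and f = g _ r in the two-term relation is what closes the induction. *)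
Lemma exchange_sum (F : fieldType) (T : eqType) (g k : T -> T -> F) (P : pred T)
    (gk : forall i j p, P i -> P j -> P p -> i != j -> i != p -> j != p ->
      k j i * g p i = k j i * g p j + k p i * k j p)
    (h f : T -> F) z q : all P (z :: q) -> uniq (z :: q) ->
  (forall j p, j \in z :: q -> p \in z :: q -> j != p ->
     h j * f p = h j * g p j + h p * k j p) ->
  h z * \prod_(p <- q) f p =
    h z * \prod_(p <- q) g p z
    + \sum_(i <- q) h i * k z i * \prod_(p <- q | p != i) g p i.
Proof.
elim: q h f => [|r q IH] h f; first by rewrite !big_nil !mulr1 addr0.
move=> /= /and3P[Pz Pr Pq] /and3P[]; rewrite inE negb_or.
move=> /andP[zr zq] rq uq hf.
have sub j : j \in z :: q -> j \in z :: r :: q.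
  by rewrite !inE => /orP[] ->; rewrite ?orbT.
have nr i : i \in z :: q -> r != i.
  rewrite inE => /predU1P[->|iq]; first by rewrite eq_sym.
  by apply: contraNneq rq => ->.
have hf_r j : j \in z :: q -> h j * f r = h j * g r j + h r * k j r.
  move=> jzq; apply: hf; first exact: sub.
    by rewrite !inE eqxx orbT.
  by rewrite eq_sym nr.
have IHh := IH h f; have IHk := IH (k^~ r) (g^~ r).
have zquniq : uniq (z :: q) by rewrite /= zq.
have allzq : all P (z :: q) by rewrite /= Pz.
have {}IHh := IHh allzq zquniq _.
have {IHh} -> : h z * \prod_(p <- r :: q) f p =
    (h z * \prod_(p <- q) g p z
    + \sum_(i <- q) h i * k z i * \prod_(p <- q | p != i) g p i) * f r.
  rewrite -IHh; first by rewrite big_cons; ring.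
  by move=> j p jq pq; apply: hf; apply: sub.
have {}IHk := IHk allzq zquniq _.
have Pin i : i \in z :: q -> P i by move/(allP allzq).
have {}IHk : k z r * \prod_(p <- q) g p r = k z r * \prod_(p <- q) g p z
    + \sum_(i <- q) k i r * k z i * \prod_(p <- q | p != i) g p i.
  by apply: IHk => j p jq pq jp; apply: gk => //; rewrite ?nr //; apply: Pin.
rewrite !big_cons eqxx /=.
have -> : \prod_(p <- q | p != r) g p r = \prod_(p <- q) g p r.
  rewrite big_seq_cond [RHS]big_seq; apply: eq_bigl => p.
  by case pq: (p \in q) => //=; rewrite eq_sym nr // inE pq orbT.
have -> : h r * k z r * \prod_(p <- q) g p r =
    h r * (k z r * \prod_(p <- q) g p r).
  by ring.
rewrite IHk mulrDr addrA addrC.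
(* By [hf_r] the factor [g r i] is traded for [f r] at the cost of a term [h r * k i r]; these terms
   form the sum in [IHk]. *)
have -> : \sum_(i <- q) h i * k z i * \prod_(p <- r :: q | p != i) g p i
   = \sum_(i <- q) h i * k z i * \prod_(p <- q | p != i) g p i * f r
   - h r * \sum_(i <- q) k i r * k z i * \prod_(p <- q | p != i) g p i.
  rewrite mulr_sumr -sumrB; apply: eq_big_seq => i iq.
  rewrite big_cons nr ?inE ?iq ?orbT //.
  have := hf_r i; rewrite inE iq orbT => /(_ isT) hi.
  by ring: hi.
have hz := hf_r z (mem_head _ _).
rewrite mulrDl mulr_suml.
by ring: hz.
Qed.

(** * The action of a single operator C on sites in state [e2] *)

Section OneParticle.

Variables (F : fieldType) (Lam : Type).
Variables (am bp bm cp cm : Lam -> Lam -> F) (N : nat) (x : 'I_N -> Lam).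

Local Notation Rm := (six_vertex_R am bp bm cp cm).
Local Notation site := (site_block am bp bm cp cm x).
Local Notation chain := (chain_block am bp bm cp cm x).
Local Notation swap := (swap_op am bp bm cp cm x).
Local Notation ket := (ket_conf F).
Implicit Types (i p z : 'I_N) (q u w : seq 'I_N) (s t : conf 'I_N).

Lemma siteA_ket i mu t :
  site i mu e1 e1 *m ket t = (if t i == e1 then 1 else bp mu (x i)) *: ket t.
Proof.
rewrite site_op_ket sum_I2 -[in RHS](upd_id t i).
by case: (I2P (t i)) => ->; rewrite upd_same /= !weightE scale0r
  ?addr0 ?add0r ?scale1r.
Qed.

Lemma siteB_ket i mu t :
  site i mu e1 e2 *m ket t =
  if t i == e1 then cp mu (x i) *: ket (upd t i e2) else 0.
Proof.
rewrite site_op_ket sum_I2.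
by case: (I2P (t i)) => ->; rewrite /= !weightE !scale0r ?addr0 ?add0r.
Qed.

Lemma siteC_ket i mu t :
  site i mu e2 e1 *m ket t =
  if t i == e2 then cm mu (x i) *: ket (upd t i e1) else 0.
Proof.
rewrite site_op_ket sum_I2.
by case: (I2P (t i)) => ->; rewrite /= !weightE !scale0r ?addr0 ?add0r.
Qed.

Lemma siteD_ket i mu t :
  site i mu e2 e2 *m ket t =
  (if t i == e1 then bm mu (x i) else am mu (x i)) *: ket t.
Proof.
rewrite site_op_ket sum_I2 -[in RHS](upd_id t i).
by case: (I2P (t i)) => ->; rewrite upd_same /= !weightE scale0r
  ?addr0 ?add0r ?scale1r.
Qed.

Lemma swap_ket_same p i a t : p != i -> t p = a -> t i = a ->
  swap p i *m ket t = (if a == e1 then 1 else am (x p) (x i)) *: ket t.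
Proof.
move=> pi tp ti; rewrite act2_ket // !sum_I2 tp ti.
have -> : ket t = ket (upd (upd t p a) i a).
  by rewrite -{1}tp upd_id -{1}ti upd_id.
case: (I2P a) => ->; rewrite -!/(weight am bp bm cp cm (x p) (x i) _ _ _ _).
  by rewrite !weightE !scale0r !addr0.
by rewrite !weightE !scale0r !add0r.
Qed.

Lemma swap_ket_21 p i t : p != i -> t p = e2 -> t i = e1 ->
  swap p i *m ket t = bm (x p) (x i) *: ket t
    + cp (x p) (x i) *: ket (upd (upd t p e1) i e2).
Proof.
move=> pi tp ti; rewrite act2_ket // !sum_I2 tp ti.
rewrite -!/(weight am bp bm cp cm (x p) (x i) _ _ _ _) !weightE !scale0r.
rewrite add0r addr0 addrC; congr (_ *: ket _ + _).
by rewrite -{1}tp upd_id -{1}ti upd_id.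
Qed.

Definition constant_on q (a : 'I_2) t := {in q, forall i, t i = a}.

Lemma constant_on_cons z q a t :
  constant_on (z :: q) a t -> t z = a /\ constant_on q a t.
Proof.
move=> tq; split; first by apply: tq; rewrite mem_head.
by move=> i iq; apply: tq; rewrite inE iq orbT.
Qed.

Lemma chainA_ket_ones q mu t : uniq q -> constant_on q e2 t ->
  chain q mu e1 e1 *m ket t = (\prod_(i <- q) bp mu (x i)) *: ket t.
Proof.
elim: q => [|z q IH] /=; first by rewrite big_nil mul_scalar_mx.
case/andP=> zq uq /constant_on_cons[tz tq].
rewrite sum_I2 mulmxDl -!mulmxA IH // [site z mu e1 e2 *m _]mulmxA.
rewrite site_op_chain_comm // -mulmxA -scalemxAr siteA_ket siteB_ket tz /=.
by rewrite mulmx0 addr0 scalerA mulrC big_cons.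
Qed.

Lemma chainB_ket_ones q mu t : uniq q -> constant_on q e2 t ->
  (chain q mu e1 e2 *m ket t = 0)
  * (chain q mu e2 e2 *m ket t = (\prod_(i <- q) am mu (x i)) *: ket t).
Proof.
elim: q => [|z q IH] /=; first by rewrite big_nil !mul_scalar_mx scale0r.
case/andP=> zq uq /constant_on_cons[tz tq].
rewrite !sum_I2 !mulmxDl -!mulmxA !IH // !mulmx0 !add0r -!scalemxAr.
by rewrite siteB_ket siteD_ket tz scaler0 scalerA mulrC big_cons.
Qed.

Lemma chainC_ket_zeros q mu t : uniq q -> constant_on q e1 t ->
  (chain q mu e2 e1 *m ket t = 0)
  * (chain q mu e2 e2 *m ket t = (\prod_(i <- q) bm mu (x i)) *: ket t).
Proof.
elim: q => [|z q IH] /=; first by rewrite big_nil !mul_scalar_mx scale0r.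
case/andP=> zq uq /constant_on_cons[tz tq].
have siteC0 a b : site z mu e2 e1 *m (chain q mu a b *m ket t) = 0.
  by rewrite mulmxA site_op_chain_comm // -mulmxA siteC_ket tz mulmx0.
rewrite !sum_I2 !mulmxDl -!mulmxA !IH // !siteC0 mulmx0 !add0r -scalemxAr.
by rewrite siteD_ket tz scalerA mulrC big_cons.
Qed.

(** On a head in state [e1] the entry C vanishes and D is diagonal, so the auxiliary index stays
    [e2] along [r] and the flip happens in [q]. *)
Lemma chainC_cat_ket r q mu t : uniq (r ++ q) -> constant_on r e1 t ->
  chain (r ++ q) mu e2 e1 *m ket t =
  (\prod_(i <- r) bm mu (x i)) *: (chain q mu e2 e1 *m ket t).
Proof.
rewrite cat_uniq => /and3P[ur qr uq] tr.
have rq : ~~ has (mem q) r by rewrite has_sym.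
rewrite chain_block_cat sum_I2 mulmxDl !(chain_comm _ _ _ _ _ _ _ _ _ _ _ _ rq).
by rewrite -!mulmxA !(chainC_ket_zeros _ ur tr) mulmx0 add0r -scalemxAr.
Qed.

(* Moves the site i to the front of q: the head of the chain acts last, so i
   passes the sites on its left, the nearest one first. *)
Fixpoint front_op q i : op_on F 'I_N :=
  if q is z :: q' then
    if z == i then 1%:M else front_op q' i *m swap z i
  else 1%:M.

Lemma site_op_front_comm Y p q i : p != i -> p \notin q ->
  site_op Y p *m front_op q i = front_op q i *m site_op Y p.
Proof.
move=> pi; elim: q => [|z q IH] /=; first by rewrite mulmx1 mul1mx.
rewrite inE negb_or => /andP[pz pq].
case: eqP => [_|/eqP zi]; first by rewrite mulmx1 mul1mx.
by rewrite mulmxA IH // -!mulmxA site_op_act2_comm.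
Qed.

(* lt p i means that p stands to the right of i in the chain under study. *)
Variable lt : rel 'I_N.
Definition right_to_left q := pairwise (fun i p => lt p i && ~~ lt i p) q.

(** With [lt] the order of the labels this is [theta] at [p], [i]; with the opposite order it is, by
    unitarity, the inverse of [theta] at [i], [p]. *)
Definition order_factor p i := if lt p i then am (x p) (x i) else 1.

(** The sites that [i] passes are those on its left, exactly the ones where [lt p i] fails, and each
    swap multiplies a pair of [e2] by [am]. *)
Lemma front_ket_ones q i t : uniq q -> i \in q -> right_to_left q ->
  constant_on q e2 t ->
  front_op q i *m ket t =
  (\prod_(p <- q | p != i) if lt p i then 1 else am (x p) (x i)) *: ket t.
Proof.
elim: q => [//|z q IH] /= /andP[zq uq]; rewrite inE => izq.
case/andP=> /allP zlt qlt /constant_on_cons[tz tq].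
case: eqVneq => [iz|zi]; rewrite ?iz big_cons ?eqxx ?zi /=.
  rewrite big_seq_cond big1 ?mul1mx ?scale1r // => p /andP[pq _].
  by case/andP: (zlt p pq); rewrite iz => ->.
have iq : i \in q by case/predU1P: izq => // iz; rewrite iz eqxx in zi.
case/andP: (zlt i iq) => _ /negPf ->.
rewrite -mulmxA (@swap_ket_same _ _ e2) //; last exact: tq.
by rewrite -scalemxAr IH // scalerA.
Qed.

Hypothesis U : unitarity Rm.
Hypothesis YB : yang_baxter Rm.
Hypothesis bm_neq0 : forall i j, i != j -> bm (x i) (x j) != 0.

Lemma am_neq0 (y1 y2 : Lam) : am y1 y2 != 0.
Proof.
by apply: contra_eq_neq (am_inv U y1 y2) => ->; rewrite mul0r eq_sym oner_neq0.
Qed.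

(** Every [p] should contribute the ratio [am / bm] at [x p], [x i]. When [front_op] acts on a chain
    of [e2] it supplies the numerators for [p] left of [i]; [order_factor] supplies the others. *)
Definition step_coef nu q i :=
  cm nu (x i) * \prod_(p <- q | p != i)
    (am nu (x p) / bm (x p) (x i) * order_factor p i).

Lemma cp_bm_div i j : i != j ->
  cp (x j) (x i) / bm (x j) (x i) = - (cm (x i) (x j) / bm (x i) (x j)).
Proof.
move=> ij; have h := cm_bm_unitarity U (x i) (x j).
have bij := bm_neq0 ij.
have bji : bm (x j) (x i) != 0 by apply: bm_neq0; rewrite eq_sym.
apply/eqP; rewrite -mulNr eqr_div //; apply/eqP.
by ring: h.
Qed.

(** An instance of [exchange_sum]: dividing [cm] and [bp] by [am nu] turns one Yang-Baxter component
    into [hf], and dividing the other by values of [bm] gives [gk]. Unitarity rewrites [k] in terms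
    of [cm]. *)
Lemma cm_prod_bp nu z q : uniq (z :: q) ->
  cm nu (x z) * \prod_(p <- q) bp nu (x p) =
  cm nu (x z) * \prod_(p <- q) (am nu (x p) * (am (x p) (x z) / bm (x p) (x z)))
  + \sum_(i <- q) cm nu (x i) * am nu (x z) * (cp (x z) (x i) / bm (x z) (x i))
    * \prod_(p <- q | p != i) (am nu (x p) * (am (x p) (x i) / bm (x p) (x i))).
Proof.
move=> uzq.
pose g p i := am (x p) (x i) / bm (x p) (x i).
pose k j i := cp (x j) (x i) / bm (x j) (x i).
pose h i := cm nu (x i) / am nu (x i).
pose f i := bp nu (x i) / am nu (x i).
have a0 p : am nu (x p) != 0 by apply: am_neq0.
have kE i j : i != j -> k j i = - (cm (x i) (x j) / bm (x i) (x j)).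
  exact: cp_bm_div.
have gk i j p : true -> true -> true -> i != j -> i != p -> j != p ->
    k j i * g p i = k j i * g p j + k p i * k j p.
  move=> _ _ _ ij ip jp.
  have pj : p != j by rewrite eq_sym.
  have pi : p != i by rewrite eq_sym.
  have := cm_bm_yang_baxter YB (x p) (x i) (x j).
  rewrite (kE i j) // (kE p j) // /g /k => yb.
  have := bm_neq0 ij; have := bm_neq0 pi; have := bm_neq0 pj => b1 b2 b3.
  field: yb. by rewrite b1 b2 b3.
have hf j p : j \in z :: q -> p \in z :: q -> j != p ->
    h j * f p = h j * g p j + h p * k j p.
  move=> _ _ jp; have pj : p != j by rewrite eq_sym.
  have := cm_bp_yang_baxter YB nu (x p) (x j).
  rewrite kE // /h /f /g => yb.
  have := bm_neq0 pj; have := a0 j; have := a0 p => b1 b2 b3.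
  field: yb. by rewrite b1 b2 b3.
have := @exchange_sum F _ g k xpredT gk h f z q _ uzq hf.
have -> : all xpredT (z :: q) by apply/allP.
move=> /(_ isT) key.
pose Q := \prod_(p <- q) am nu (x p).
have -> : \prod_(p <- q) bp nu (x p) = \prod_(p <- q) f p * Q.
  by rewrite -big_split /=; apply: eq_bigr => p _; rewrite /f divfK.
have -> : cm nu (x z) = h z * am nu (x z) by rewrite /h divfK.
transitivity (am nu (x z) * Q * (h z * \prod_(p <- q) f p)); first by ring.
rewrite key mulrDr; congr (_ + _).
  by rewrite [in RHS]big_split /= -/Q; ring.
rewrite mulr_sumr; apply: eq_big_seq => i iq.
have -> : Q = am nu (x i) * \prod_(p <- q | p != i) am nu (x p).
  by rewrite /Q (bigD1_seq i) //=; case/andP: uzq.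
rewrite [in RHS]big_split /= -/(k z i) -[cm nu (x i)](divfK (a0 i)) -/(h i).
by ring.
Qed.

(** Induction on the chain: either the head [z] flips and A acts on the rest, or z acts by D and the
    flip occurs in the rest. The swaps [swap z i] of the claimed expansion produce further vectors
    flipped at [z], and [cm_prod_bp] balances them. *)
Lemma chainC_ket_ones nu q t : uniq q -> right_to_left q ->
  constant_on q e2 t ->
  chain q nu e2 e1 *m ket t =
  \sum_(i <- q) step_coef nu q i *: (front_op q i *m ket (upd t i e1)).
Proof.
elim: q => [|z q IH]; first by rewrite big_nil mul_scalar_mx scale0r.
move=> uzq; have /= /andP[zq uq] := uzq.
move=> /= /andP[/allP zlt qlt] /constant_on_cons[tz tq].
have nz i : i \in q -> z != i by apply: contraTneq => <-.
rewrite sum_I2 mulmxDl -!mulmxA chainA_ket_ones // IH // -scalemxAr.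
rewrite siteC_ket tz.
rewrite eqxx scalerA mulrC big_cons eqxx mul1mx mulmx_sumr.
pose K i := \prod_(p <- q | p != i) if lt p i then 1 else am (x p) (x i).
(* The swap leaves the flip at [i] or transfers it to [z]; in the second case [front_op] meets only
   [e2]. *)
have front_swap i : i \in q -> front_op q i *m swap z i *m ket (upd t i e1) =
    bm (x z) (x i) *: (front_op q i *m ket (upd t i e1))
    + (cp (x z) (x i) * K i) *: ket (upd t z e1).
  move=> iq; have zi := nz i iq; have iz : i != z by rewrite eq_sym.
  rewrite -mulmxA swap_ket_21 // ?upd_same ?upd_other //.
  rewrite (updC _ _ _ zi) upd_upd.
  have -> : upd t i e2 = t by rewrite -(tq i iq) upd_id.
  have tzq : constant_on q e2 (upd t z e1).
    by move=> p pq; rewrite upd_other ?tq // eq_sym nz.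
  by rewrite mulmxDr -!scalemxAr (front_ket_ones uq iq qlt tzq) scalerA.
have siteD_front i : i \in q ->
    site z nu e2 e2 *m (step_coef nu q i *: (front_op q i *m ket (upd t i e1)))
    = (step_coef nu q i * am nu (x z)) *: (front_op q i *m ket (upd t i e1)).
  move=> iq; have zi := nz i iq.
  rewrite -scalemxAr mulmxA site_op_front_comm // -mulmxA siteD_ket upd_other //.
  by rewrite tz -scalemxAr scalerA.
under [X in _ + X = _]eq_big_seq => i iq do rewrite siteD_front //.
have coef_cons i : i \in q ->
    step_coef nu (z :: q) i = step_coef nu q i * (am nu (x z) / bm (x z) (x i)).
  move=> iq; have zi := nz i iq; rewrite /step_coef big_cons zi.
  have -> : order_factor z i = 1.
    by rewrite /order_factor; case/andP: (zlt i iq) => _ /negPf ->.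
  by ring.
transitivity (step_coef nu (z :: q) z *: ket (upd t z e1) +
  \sum_(i <- q) (
    (step_coef nu q i * am nu (x z)) *: (front_op q i *m ket (upd t i e1))
    + (step_coef nu (z :: q) i * (cp (x z) (x i) * K i))
        *: ket (upd t z e1))); last first.
  congr (_ + _); apply: eq_big_seq => i iq; have zi := nz i iq.
  rewrite (negPf zi) front_swap // scalerDr !scalerA.
  congr (_ *: _ + _).
  by rewrite coef_cons // -mulrA divfK // bm_neq0.
rewrite big_split /= [RHS]addrCA -scaler_suml -scalerDl [LHS]addrC.
congr (_ + _ *: _).
(* The vectors flipped inside [q] already agree; only the coefficient of the one flipped at [z]
   remains. *)
rewrite cm_prod_bp //; congr (_ + _).
  rewrite /step_coef big_cons eqxx /=; congr (_ * _).
  rewrite big_seq [RHS]big_seq_cond; apply: eq_big => p.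
    by case pq: (p \in q) => //=; rewrite eq_sym nz.
  move=> pq; rewrite /order_factor; case/andP: (zlt p pq) => -> _; ring.
apply: eq_big_seq => i iq; rewrite coef_cons // /step_coef /K.
have -> : \prod_(p <- q | p != i) (am nu (x p) * (am (x p) (x i) / bm (x p) (x i)))
  = \prod_(p <- q | p != i) (am nu (x p) / bm (x p) (x i) * order_factor p i) *
    \prod_(p <- q | p != i) (if lt p i then 1 else am (x p) (x i)).
  rewrite -big_split; apply: eq_bigr => p _; rewrite /order_factor.
  by case: ifP => _ /=; ring.
by ring.
Qed.

End OneParticle.

(** * Injective choices of sites, built one site at a time *)

Section FfunCons.

Variables (T : finType) (n : nat).

Definition ffun_cons (i : T) (g : {ffun 'I_n -> T}) : {ffun 'I_n.+1 -> T} :=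
  [ffun k => if unlift ord0 k is Some j then g j else i].

Lemma ffun_cons0 i g : ffun_cons i g ord0 = i.
Proof. by rewrite ffunE unlift_none. Qed.

Lemma ffun_consS i g k : ffun_cons i g (lift ord0 k) = g k.
Proof. by rewrite ffunE liftK. Qed.

Lemma codom_ffun_cons i g : codom (ffun_cons i g) = i :: codom g.
Proof.
rewrite /codom /image_mem enum_ordSl /= ffun_cons0 -map_comp; congr (_ :: _).
by apply: eq_map => k /=; rewrite ffun_consS.
Qed.

Lemma sum_ffun_cons (V : nmodType) (P : pred {ffun 'I_n.+1 -> T}) H :
  \sum_(v | P v) H v =
  \sum_(i : T) \sum_(g : {ffun 'I_n -> T} | P (ffun_cons i g))
    H (ffun_cons i g) :> V.
Proof.
rewrite pair_big_dep /=.
rewrite (reindex (fun ig : T * {ffun 'I_n -> T} => ffun_cons ig.1 ig.2)) //=.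
exists (fun v => (v ord0, [ffun k => v (lift ord0 k)])) => [[i g]|v] _ /=.
  rewrite ffun_cons0; congr (_, _).
  by apply/ffunP => k; rewrite ffunE ffun_consS.
apply/ffunP => k; case: (unliftP ord0 k) => [j|] ->.
  by rewrite ffun_consS ffunE.
by rewrite ffun_cons0.
Qed.

End FfunCons.

Definition injective_in (T : finType) n (q : seq T) (v : {ffun 'I_n -> T}) :=
  uniq (codom v) && all (mem q) (codom v).

Lemma injective_in_cons (T : finType) n (q : seq T) i (g : {ffun 'I_n -> T}) :
  uniq q ->
  injective_in q (ffun_cons i g) = (i \in q) && injective_in (rem i q) g.
Proof.
move=> uq; rewrite /injective_in codom_ffun_cons /=; move: (codom g) => c.
have -> : all (mem (rem i q)) c = (i \notin c) && all (mem q) c.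
  apply/allP/andP => [cq|[ic /allP cq] p pc] /=.
    split; first by apply/negP => /cq /=; rewrite mem_rem_uniq // inE eqxx.
    by apply/allP => p /cq /mem_rem.
  rewrite mem_rem_uniq // inE (cq p pc : p \in q) andbT.
  by apply: contraNneq ic => <-.
by case: (i \in q); case: (i \in c); case: (uniq c); rewrite /= ?andbF.
Qed.

(** * Iterating the one-step expansion over a product of operators C *)

Section Expansion.

Variables (F : fieldType) (Lam : Type).
Variables (am bp bm cp cm : Lam -> Lam -> F) (N : nat) (x : 'I_N -> Lam).

Local Notation Rm := (six_vertex_R am bp bm cp cm).
Local Notation chain := (chain_block am bp bm cp cm x).
Local Notation swap := (swap_op am bp bm cp cm x).
Local Notation front_op := (front_op am bp bm cp cm x).
Local Notation ket := (ket_conf F).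
Implicit Types (i p z : 'I_N) (q u w r S : seq 'I_N) (s t : conf 'I_N).
Implicit Type Y : seq 'I_N -> 'rV[F]_(tensor_dim 'I_N).

(* A family of rows, one for each order of the sites of S, that the operators
   R_{p i} carry into one another. *)
Definition exchangeable S Y := forall u p i w,
  perm_eq (u ++ p :: i :: w) S ->
  Y (u ++ p :: i :: w) *m swap p i = Y (u ++ i :: p :: w).

(** Each factor of [front_op] is one adjacent exchange, carrying [i] one place further to the
    left. *)
Lemma exchangeable_front S Y u q i : exchangeable S Y -> uniq S ->
  perm_eq (u ++ q) S -> i \in q ->
  Y (u ++ q) *m front_op q i = Y (u ++ i :: rem i q).
Proof.
move=> exY uS; elim: q u => [//|z q IH] u /= uqS; rewrite inE => izq.
case: eqVneq => [->|zi]; first by rewrite mulmx1.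
have iq : i \in q by case/predU1P: izq => // iz; rewrite iz eqxx in zi.
rewrite mulmxA -cat_rcons IH ?cat_rcons // exY //.
apply: perm_trans uqS; rewrite perm_cat2l perm_cons perm_sym.
exact: perm_to_rem.
Qed.

Hypothesis YB : yang_baxter Rm.

(** By [chain_exchange] a swap passes the chain while reordering it, and then reorders [Y]. *)
Lemma exchangeable_chain S Y mu a b : uniq S -> exchangeable S Y ->
  exchangeable S (fun q => Y q *m chain q mu a b).
Proof.
move=> uS exY u p i w uS'; have uS2 := uS; rewrite -(perm_uniq uS') in uS2.
by rewrite -mulmxA chain_exchange // mulmxA exY.
Qed.

Lemma exchangeable_prod S Y n (mu : 'I_n -> Lam) a b :
  uniq S -> exchangeable S Y ->
  exchangeable S (fun q => Y q *m \prod_k chain q (mu k) a b).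
Proof.
move=> uS exY; elim: n mu => [|n IH] mu u p i w uS'.
  by rewrite !big_ord0 -idmxE !mulmx1 exY.
rewrite !big_ord_recr /= -!mulmxE !mulmxA.
exact: (exchangeable_chain _ _ _ uS (IH (mu \o widen_ord (leqnSn n)))).
Qed.

Variable lt : rel 'I_N.
Local Notation order_factor := (order_factor am x lt).
Local Notation step_coef := (step_coef am bm cm x lt).

(** Site [i1] is flipped before [i2]: the first factor comes from the later operator crossing [i1]
    in front, the rest is the contribution of [i2] to the earlier [step_coef]. *)
Definition pair_weight (nu1 nu2 : Lam) i1 i2 :=
  bm nu2 (x i1) * am nu1 (x i2) / bm (x i2) (x i1) * order_factor i2 i1.

Definition rest_weight (nu : Lam) i p :=
  am nu (x p) / bm (x p) (x i) * order_factor p i.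

(** In order: the flips, the crossings of the head [r] flipped beforehand, the pairs of new flips,
    and the sites of [q] that stay unflipped. *)
Definition config_weight n (nu : 'I_n -> Lam) r q
    (v : {ffun 'I_n -> 'I_N}) : F :=
  (\prod_k cm (nu k) (x (v k)))
  * (\prod_k \prod_(j <- r) bm (nu k) (x j))
  * (\prod_(j < n) \prod_(k < n | (j < k)%N)
       pair_weight (nu j) (nu k) (v j) (v k))
  * (\prod_k \prod_(p <- q | p \notin codom v) rest_weight (nu k) (v k) p).

Lemma config_weight_cons n (nu : 'I_n.+1 -> Lam) r q i
    (g : {ffun 'I_n -> 'I_N}) :
  uniq q -> i \in q -> injective_in (rem i q) g ->
  config_weight nu r q (ffun_cons i g) =
  (\prod_(j <- r) bm (nu ord0) (x j)) * step_coef (nu ord0) q i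
  * config_weight (nu \o lift ord0) (rcons r i) (rem i q) g.
Proof.
move=> uq iq /andP[ug /allP gq]; rewrite /config_weight codom_ffun_cons.
have restE (f : 'I_N -> F) : \prod_(p <- q | p \notin i :: codom g) f p
    = \prod_(p <- rem i q | p \notin codom g) f p.
  rewrite (rem_filter i uq) big_filter_cond; apply: eq_bigl => p.
  by rewrite inE negb_or.
(* A site other than [i] is either flipped later, which feeds a pair factor, or never, which feeds
   the last product. *)
have step : \prod_(p <- q | p != i) rest_weight (nu ord0) i p =
    (\prod_(p <- rem i q | p \notin codom g) rest_weight (nu ord0) i p)
    * \prod_k rest_weight (nu ord0) i (g k).
  rewrite -[LHS](big_filter q (fun p => p != i)) -(rem_filter i uq).
  rewrite (bigID (mem (codom g))) /= mulrC; congr (_ * _).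
  rewrite -big_filter (perm_big (codom g)).
    by rewrite /codom /image_mem big_map big_enum.
  apply: uniq_perm => //; first by rewrite filter_uniq // rem_uniq.
  by move=> p; rewrite mem_filter andb_idr // => /gq.
rewrite /step_coef -/(rest_weight _ _ _) step.
rewrite !big_ord_recl !ffun_cons0 /=.
under eq_bigr => k _ do rewrite ffun_consS.
rewrite restE.
under [X in _ * (_ * X) = _]eq_bigr => k _ do rewrite restE ffun_consS.
have -> : \prod_(k < n.+1 | (0 < k)%N)
      pair_weight (nu ord0) (nu k) i (ffun_cons i g k)
    = \prod_(k < n) pair_weight (nu ord0) (nu (lift ord0 k)) i (g k).
  rewrite big_mkcond big_ord_recl /= mul1r; apply: eq_bigr => k _.
  by rewrite ffun_consS.
have -> : \prod_(j < n) \prod_(k < n.+1 | (lift ord0 j < k)%N)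
      pair_weight (nu (lift ord0 j)) (nu k)
        (ffun_cons i g (lift ord0 j)) (ffun_cons i g k)
    = \prod_(j < n) \prod_(k < n | (j < k)%N)
      pair_weight (nu (lift ord0 j)) (nu (lift ord0 k)) (g j) (g k).
  apply: eq_bigr => j _; rewrite big_mkcond big_ord_recl /= mul1r.
  rewrite [RHS]big_mkcond; apply: eq_bigr => k _.
  by rewrite !ffun_consS.
have -> : \prod_(k < n) \prod_(j <- rcons r i) bm (nu (lift ord0 k)) (x j)
    = \prod_(k < n) \prod_(j <- r) bm (nu (lift ord0 k)) (x j)
      * \prod_(k < n) bm (nu (lift ord0 k)) (x i).
  by rewrite -big_split; apply: eq_bigr => k _; rewrite big_rcons.
have -> : \prod_(k < n) pair_weight (nu ord0) (nu (lift ord0 k)) i (g k) =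
  \prod_(k < n) bm (nu (lift ord0 k)) (x i)
  * \prod_(k < n) rest_weight (nu ord0) i (g k).
  rewrite -big_split /=; apply: eq_bigr => k _.
  by rewrite /pair_weight /rest_weight !mulrA.
by ring.
Qed.

Hypothesis U : unitarity Rm.
Hypothesis bm_neq0 : forall i j, i != j -> bm (x i) (x j) != 0.

Definition lower n (v : {ffun 'I_n -> 'I_N}) t : conf 'I_N :=
  [ffun p => if p \in codom v then e1 else t p].

(** Induction on the number of operators, peeling off the rightmost, which acts first. Its expansion
    over [i] leaves a chain with [i] moved to the end of the flipped head, so the hypothesis applies
    to [rcons r i] and [rem i q]. *)
Lemma expansion n (nu : 'I_n -> Lam) Y S r q t : exchangeable S Y -> uniq S ->
  perm_eq (r ++ q) S -> right_to_left lt q ->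
  constant_on r e1 t -> constant_on q e2 t ->
  (Y (r ++ q) *m (\prod_(k < n) chain (r ++ q) (nu (rev_ord k)) e2 e1)
     *m ket t) 0 0 =
  \sum_(v | injective_in q v) config_weight nu r q v *
    (Y (r ++ codom v ++ [seq p <- q | p \notin codom v])
       *m ket (lower v t)) 0 0.
Proof.
move=> exY uS; elim: n nu r q t => [|n IH] nu r q t rqS qlt tr tq.
  pose v0 : {ffun 'I_0 -> 'I_N} := [ffun k => tnth [tuple] k].
  have c0 (v : {ffun 'I_0 -> 'I_N}) : codom v = [::].
    by apply: size0nil; rewrite size_codom card_ord.
  rewrite (bigD1 v0) /=; last by rewrite /injective_in /= c0.
  rewrite [X in _ + X]big1 ?addr0; last first.
    by move=> v /andP[_ /eqP[]]; apply/ffunP => -[].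
  rewrite /config_weight c0 !big_ord0 !mul1r -idmxE mulmx1 /= filter_predT.
  by congr ((_ *m ket _) 0 0); apply/ffunP => p; rewrite ffunE c0.
have urq : uniq (r ++ q) by rewrite (perm_uniq rqS).
have uq : uniq q by move: urq; rewrite cat_uniq => /and3P[].
(* The remaining operators C join the row, so that the swaps reorder their chains too. *)
pose Y' w := Y w *m \prod_(k < n) chain w (nu (lift ord0 (rev_ord k))) e2 e1.
have exY' : exchangeable S Y' by apply: exchangeable_prod.
rewrite big_ord_recr /= -mulmxE mulmxA.
have -> : rev_ord ord_max = ord0 :> 'I_n.+1 by apply: val_inj; rewrite /= subnn.
have -> : \prod_(k < n)
      chain (r ++ q) (nu (rev_ord (widen_ord (leqnSn n) k))) e2 e1
    = \prod_(k < n) chain (r ++ q) (nu (lift ord0 (rev_ord k))) e2 e1.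
  apply: eq_bigr => k _; congr (chain _ (nu _) _ _); apply: val_inj.
  by rewrite /= /bump /= add1n subSn.
rewrite -/(Y' (r ++ q)) -mulmxA chainC_cat_ket //.
rewrite (@chainC_ket_ones _ _ _ _ _ _ _ _ _ lt) //.
rewrite -scalemxAr mulmx_sumr scaler_sumr summxE.
rewrite sum_ffun_cons.
under [RHS]eq_bigr => i _ do under eq_bigl => g do rewrite injective_in_cons //.
rewrite [RHS](bigID (mem q)) /= [X in _ = _ + X]big1 ?addr0; last first.
  by move=> i /negPf iq; rewrite big_pred0 // => g; rewrite iq.
rewrite -big_uniq //; apply: eq_big_seq => i iq.
rewrite -scalemxAr scalerA mulmxA (exchangeable_front exY') // mxE -cat_rcons.
rewrite /Y' (IH (nu \o lift ord0)).
- rewrite mulr_sumr; apply: eq_big => g; first by rewrite iq.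
  move=> gq; rewrite config_weight_cons // mulrA codom_ffun_cons.
  congr (_ * fun_of_matrix (Y _ *m ket _) 0 0).
    rewrite cat_rcons /= (rem_filter i uq) -filter_predI.
    congr (_ ++ _ :: _ ++ _).
    by apply: eq_filter => p /=; rewrite inE negb_or andbC.
  apply/ffunP => p; rewrite !ffunE codom_ffun_cons inE updE.
  by case: (p == i); rewrite ?if_same.
- apply: perm_trans rqS; rewrite cat_rcons perm_cat2l perm_sym.
  exact: perm_to_rem.
- by rewrite /right_to_left (rem_filter i uq); apply: pairwise_filter.
- move=> p; rewrite mem_rcons inE => /predU1P[->|pr]; first by rewrite upd_same.
  rewrite upd_other ?tr //; apply: contraTneq iq => <-.
  by move: urq; rewrite cat_uniq => /and3P[_ /hasPn h _];
    apply: contraL pr => /h.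
move=> p; rewrite (mem_rem_uniq i uq) inE => /andP[pi pq].
by rewrite upd_other ?tq.
Qed.

End Expansion.

(** * Transposition, which exchanges the weights [cp] and [cm] *)

Section Transposition.

Variables (F : fieldType) (Lam : Type).
Variables (am bp bm cp cm : Lam -> Lam -> F) (N : nat) (x : 'I_N -> Lam).

Local Notation Rm := (six_vertex_R am bp bm cp cm).
Local Notation Rt := (six_vertex_R am bp bm cm cp).

Lemma unitarity_trmx : unitarity Rm -> unitarity Rt.
Proof.
(* Transposing reverses the product, and a one-sided inverse of a square matrix is two-sided. *)
move=> U y1 y2; apply: mulmx1C; apply: trmx_inj.
by rewrite trmx_mul !trmx_act2 !trmx_six_vertex trmx1 mulmxE U.
Qed.

Lemma yang_baxter_trmx : yang_baxter Rm -> yang_baxter Rt.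
Proof.
move=> YB y1 y2 y3 /=; apply: trmx_inj; rewrite -!mulmxE !trmx_mul.
by rewrite !trmx_act2 !trmx_six_vertex !mulmxA !mulmxE YB.
Qed.

Lemma trmx_swap_op p i :
  (swap_op am bp bm cp cm x p i)^T = swap_op am bp bm cm cp x p i.
Proof. by rewrite trmx_act2 trmx_six_vertex. Qed.

(** Transposing the full monodromy matrix reverses its factors and exchanges the auxiliary
    indices. *)
Lemma trmx_chain_block q mu a b :
  (chain_block am bp bm cp cm x q mu a b)^T =
  chain_block am bp bm cm cp x (rev q) mu b a.
Proof.
elim: q a => [|i q IH] a /=; first by rewrite tr_scalar_mx eq_sym.
rewrite raddf_sum rev_cons -cats1 chain_block_cat; apply: eq_bigr => c _ /=.
rewrite trmx_mul IH; congr (_ *m _).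
rewrite (bigD1 a) //= eqxx mulmx1 big1 ?addr0; last first.
  by move=> d /negPf ->; rewrite mul_mx_scalar scale0r.
rewrite trmx_site_op; apply: eq_site_op => d d'.
by rewrite /weight -(trmx_six_vertex am bp bm cp cm) [RHS]mxE.
Qed.

Lemma bra_swap_op p i a (t : conf 'I_N) : p != i -> t p = a -> t i = a ->
  (ket_conf F t)^T *m swap_op am bp bm cp cm x p i =
  (if a == e1 then 1 else am (x p) (x i)) *: (ket_conf F t)^T.
Proof.
move=> pi tp ti; apply: trmx_inj; rewrite trmx_mul trmxK trmx_swap_op.
by rewrite (swap_ket_same _ _ _ _ _ _ pi tp ti) linearZ /= trmxK.
Qed.

End Transposition.

Lemma trmx_prod (F : fieldType) d n (A : 'I_n -> 'M[F]_d) :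
  (\prod_(k < n) A k)^T = \prod_(k < n) (A (rev_ord k))^T.
Proof.
elim: n A => [|n IH] A; first by rewrite !big_ord0 -idmxE trmx1.
rewrite big_ord_recl big_ord_recr -!mulmxE trmx_mul IH /=; congr (_ *m _^T).
  apply: eq_bigr => k _; congr (A _)^T; apply: val_inj.
  by rewrite /= /bump /= add1n subSn.
by congr A; apply: val_inj; rewrite /= subnn.
Qed.

(** * Domain wall matrix elements as sums over injective choices *)

Section DomainWall.

Variables (F : fieldType) (Lam : Type).
Variables (am bp bm cp cm : Lam -> Lam -> F) (N : nat) (x : 'I_N -> Lam).

Local Notation Rm := (six_vertex_R am bp bm cp cm).
Local Notation chain := (chain_block am bp bm cp cm x).
Local Notation ket := (ket_conf F).

Hypothesis U : unitarity Rm.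
Hypothesis YB : yang_baxter Rm.
Hypothesis bm_neq0 : forall i j, i != j -> bm (x i) (x j) != 0.
Variable lt : rel 'I_N.

(** This is what [config_weight] becomes with an empty head and every site flipped. *)
Definition dw_weight n (nu : 'I_n -> Lam) (v : 'I_n -> 'I_N) : F :=
  (\prod_k cm (nu k) (x (v k)))
  * \prod_(j < n) \prod_(k < n | (j < k)%N)
      pair_weight am bm x lt (nu j) (nu k) (v j) (v k).

Lemma injective_in_full n q (v : {ffun 'I_n -> 'I_N}) : uniq q -> size q = n ->
  injective_in q v -> codom v =i q.
Proof.
move=> uq qn /andP[uv /allP vq].
by case: (uniq_min_size uv vq); rewrite // size_codom card_ord qn.
Qed.

(** The constant row is exchangeable because R fixes the pair [e1], [e1]. With as many operators as
    sites all of [q] is flipped, and the final pairing is 1. *)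
Lemma domain_wall_expansion n (nu : 'I_n -> Lam) q (t0 t : conf 'I_N) :
  uniq q -> size q = n -> right_to_left lt q ->
  constant_on q e1 t0 -> constant_on q e2 t ->
  (forall p, p \notin q -> t p = t0 p) ->
  ((ket t0)^T *m (\prod_(k < n) chain q (nu (rev_ord k)) e2 e1) *m ket t) 0 0 =
  \sum_(v : {ffun 'I_n -> 'I_N} | injective_in q v) dw_weight nu v.
Proof.
move=> uq qn qlt t0q tq tt0.
have exY : exchangeable am bp bm cp cm x q (fun=> (ket t0)^T).
  move=> u p i w uq'; have := uq; rewrite -(perm_uniq uq') cat_uniq.
  case/and3P=> _ _ /= /andP[]; rewrite inE negb_or => /andP[pi _] _.
  have [pq iq] : p \in q /\ i \in q.
    by split; rewrite -(perm_mem uq') mem_cat !inE eqxx !orbT.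
  by rewrite (bra_swap_op _ _ _ _ _ _ pi (t0q p pq) (t0q i iq)) scale1r.
have t_nil : constant_on [::] e1 t by [].
rewrite [LHS](@expansion _ _ _ _ _ _ _ _ _ YB lt U bm_neq0 n nu _ _ [::] q t
  exY uq (perm_refl q) qlt t_nil tq).
apply: eq_bigr => v vq; have vqE := injective_in_full uq qn vq.
have -> : lower v t = t0.
  apply/ffunP => p; rewrite ffunE vqE; case: ifP => [/t0q //|/negbT].
  exact: tt0.
rewrite mxE [X in _ * X](_ : _ = 1) ?mulr1; last first.
  rewrite (bigD1 (rank_of t0)) //= !mxE !eqxx mulr1 big1 ?addr0 // => r rt0.
  by rewrite !mxE (negPf rt0) mul0r.
rewrite /config_weight /dw_weight.
rewrite [X in _ * X * _ * _]big1 ?mulr1; last by move=> k _; rewrite big_nil.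
rewrite [X in _ * X]big1 ?mulr1 // => k _.
by rewrite big_seq_cond big1 // => p /andP[pq]; rewrite vqE pq.
Qed.

End DomainWall.

(** * Injective choices as increasing choices followed by permutations *)

Section Reindexing.

Variables (n N : nat).
Implicit Types (v l : {ffun 'I_n -> 'I_N}).

Definition ffun_perm l (s : 'S_n) : {ffun 'I_n -> 'I_N} := [ffun k => l (s k)].

Lemma codom_ffun_perm l s : codom (ffun_perm l s) =i codom l.
Proof.
move=> p; apply/codomP/codomP => [[k ->]|[k ->]].
  by exists (s k); rewrite ffunE.
by exists (s^-1%g k); rewrite ffunE permKV.
Qed.

Lemma uniq_codomP v : reflect (injective v) (uniq (codom v)).
Proof. exact: injectiveP. Qed.

Lemma injective_inP l q v : injective l -> codom l =i q ->
  reflect (exists s, v = ffun_perm l s) (injective_in q v).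
Proof.
move=> injl lq; apply: (iffP andP) => [[uv /allP vq]|[s ->]]; last first.
  split; last by apply/allP => p; rewrite codom_ffun_perm lq.
  by apply/uniq_codomP => j k; rewrite !ffunE => /injl/perm_inj.
have vl k : v k \in codom l by rewrite lq; apply: vq; apply: codom_f.
have inj_f : injective (fun k => iinv (vl k)).
  by move=> j k /(congr1 l); rewrite !f_iinv; apply/uniq_codomP.
by exists (perm inj_f); apply/ffunP => k; rewrite ffunE permE f_iinv.
Qed.

Lemma sum_injective_in (V : nmodType) l q (H : {ffun 'I_n -> 'I_N} -> V) :
  injective l -> codom l =i q ->
  \sum_(v | injective_in q v) H v = \sum_(s : 'S_n) H (ffun_perm l s).
Proof.
move=> injl lq.
rewrite -[RHS](big_imset (A := predT) H); last first.
  move=> s s' _ _ /ffunP ss'; apply/permP => k.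
  by apply: injl; have := ss' k; rewrite !ffunE.
apply: eq_bigl => v; apply/(injective_inP v injl lq)/imsetP => [[s ->]|[s _ ->]].
  by exists s.
by exists s.
Qed.

Definition sort_ffun v : {ffun 'I_n -> 'I_N} :=
  [ffun k : 'I_n =>
     nth (v k) (sort (fun i j : 'I_N => (i <= j)%N) (codom v)) k].

Lemma increasingP l :
  reflect (forall i j : 'I_n, (i < j)%N -> (l i < l j)%N) (increasing l).
Proof.
apply: (iffP forallP) => [h i j ij|h i].
  by have /forallP/(_ j)/implyP := h i; apply.
by apply/forallP => j; apply/implyP; apply: h.
Qed.

Lemma increasing_ltn l (i j : 'I_n) : increasing l -> (l i < l j)%N = (i < j)%N.
Proof.
move=> /increasingP incl; apply/idP/idP; last exact: incl.
apply: contraTT; rewrite -!leqNgt leq_eqVlt => /orP[/eqP/val_inj -> //|ji].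
exact: ltnW (incl _ _ ji).
Qed.

Lemma increasing_inj l : increasing l -> injective l.
Proof.
move=> incl i j lij; case: (ltngtP i j) => [ij|ji|/val_inj //].
  by rewrite -(increasing_ltn _ _ incl) lij ltnn in ij.
by rewrite -(increasing_ltn _ _ incl) lij ltnn in ji.
Qed.

Lemma pairwise_enum_ord m : pairwise (fun i j : 'I_m => (i < j)%N) (enum 'I_m).
Proof.
rewrite -(pairwise_map val ltn) val_enum_ord -sorted_pairwise; last exact: ltn_trans.
exact: iota_ltn_sorted.
Qed.

Lemma pairwise_increasing l :
  increasing l -> pairwise (fun i j : 'I_N => (i < j)%N) (codom l).
Proof.
move=> /increasingP incl; rewrite pairwise_map.
by apply: sub_pairwise (pairwise_enum_ord n) => i j; apply: incl.
Qed.

Lemma codom_sort_ffun v :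
  codom (sort_ffun v) = sort (fun i j : 'I_N => (i <= j)%N) (codom v).
Proof.
set q := sort _ _; have qn : size q = n by rewrite size_sort size_codom card_ord.
have [n0|n_gt0] := posnP n.
  have -> : q = [::] by apply: size0nil; rewrite qn.
  by apply: size0nil; rewrite size_codom card_ord.
pose k0 := Ordinal n_gt0.
apply: (@eq_from_nth _ (v k0)); rewrite size_codom card_ord ?qn // => k kn.
rewrite (nth_map k0) ?size_enum_ord // ffunE nth_enum_ord //.
by apply: set_nth_default; rewrite qn.
Qed.

Lemma sort_ffun_increasing v : uniq (codom v) -> increasing (sort_ffun v).
Proof.
move=> uv; apply/increasingP => i j ij.
have vE (k : 'I_n) :
    sort_ffun v k = nth (v i) (sort (fun i j : 'I_N => (i <= j)%N) (codom v)) k.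
  by rewrite ffunE; apply: set_nth_default; rewrite size_sort size_codom card_ord.
rewrite !vE; set q := sort _ _.
have qn : size q = n by rewrite size_sort size_codom card_ord.
rewrite ltn_neqAle; apply/andP; split.
  by rewrite (inj_eq val_inj) nth_uniq ?qn ?sort_uniq // neq_ltn ij.
have := @sorted_ltn_nth _ (fun i j : 'I_N => (i <= j)%N).
apply => //; rewrite ?inE ?qn //; first by move=> y x z; apply: leq_trans.
by apply: sort_sorted => y z; apply: leq_total.
Qed.

Lemma sort_ffun_eq v l : uniq (codom v) -> increasing l ->
  (sort_ffun v == l) = injective_in (codom l) v.
Proof.
move=> uv incl; have ul : uniq (codom l) by apply/uniq_codomP/increasing_inj.
apply/eqP/andP => [<-|[_ /allP vl]].
  by split=> //; apply/allP => p; rewrite codom_sort_ffun /= mem_sort.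
have perm_vl : perm_eq (codom v) (codom l).
  apply: uniq_perm => //.
  by case: (uniq_min_size uv vl); rewrite // !size_codom.
have eq_codom : codom (sort_ffun v) = codom l.
  rewrite codom_sort_ffun; apply: (@sorted_eq _ (fun i j : 'I_N => (i <= j)%N)).
  - by move=> y x z; apply: leq_trans.
  - by move=> y z /anti_leq/val_inj.
  - by apply: sort_sorted => y z; apply: leq_total.
  - apply: pairwise_sorted; apply: sub_pairwise (pairwise_increasing incl) => i j.
    exact: ltnW.
  - by rewrite perm_sort.
by apply/ffunP => k; have /eq_in_map/(_ k) := eq_codom; apply; rewrite mem_enum.
Qed.

(** The sum is grouped by [sort_ffun], whose fibres consist of the orderings of one increasing
    choice. *)
Lemma sum_injective (V : nmodType) q (H : {ffun 'I_n -> 'I_N} -> V) :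
  (forall p, p \in q) ->
  \sum_(v | injective_in q v) H v =
  \sum_(l | increasing l) \sum_(s : 'S_n) H (ffun_perm l s).
Proof.
move=> qT; rewrite (partition_big sort_ffun (@increasing n N)) /=; last first.
  by move=> v /andP[/sort_ffun_increasing].
apply: eq_bigr => l incl.
rewrite -(sum_injective_in H (increasing_inj incl) (fun=> erefl)).
apply: eq_bigl => v; case uv: (uniq (codom v)); last by rewrite /injective_in uv.
rewrite sort_ffun_eq //; rewrite [injective_in q v]/injective_in uv.
by rewrite (_ : all _ _) //; apply/allP => p _; apply: qT.
Qed.

End Reindexing.

(** Adjacent exchanges generate all reorderings: the head of one sequence is found in the other,
    brought to its front, and appended to the fixed prefix [u]. *)
Lemma perm_invariant (T : eqType) (V : Type) (f : seq T -> V) s0 :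
  (forall u p i w, perm_eq (u ++ p :: i :: w) s0 ->
     f (u ++ p :: i :: w) = f (u ++ i :: p :: w)) ->
  forall s, perm_eq s s0 -> f s = f s0.
Proof.
move=> fswap.
have front u w1 z w2 : perm_eq (u ++ w1 ++ z :: w2) s0 ->
    f (u ++ w1 ++ z :: w2) = f (u ++ z :: w1 ++ w2).
  elim/last_ind: w1 w2 => [//|w1 y IH] w2 h.
  rewrite -!cats1 -!catA /= in h *.
  rewrite catA fswap -?catA // IH //.
  apply: perm_trans h; rewrite !perm_cat2l.
  by rewrite -[z :: y :: w2]/([:: z; y] ++ w2) -[y :: z :: w2]/([:: y; z] ++ w2)
     perm_cat2r; apply/seq.permP => a /=; rewrite addnCA.
have main u s t : perm_eq s t -> perm_eq (u ++ s) s0 -> f (u ++ s) = f (u ++ t).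
  elim: s u t => [|z s IH] u t st us0.
    by rewrite perm_sym in st; rewrite (perm_nilP st).
  have zt : z \in t by rewrite -(perm_mem st) mem_head.
  case/splitPr: t / zt st => w1 w2 st.
  have st' : perm_eq s (w1 ++ w2).
    by rewrite -(perm_cons z) (perm_trans st) // -cat1s perm_catCA.
  rewrite front; last first.
    by apply: perm_trans us0; rewrite perm_cat2l perm_sym.
  by rewrite -!cat_rcons (IH (rcons u z) (w1 ++ w2)) // cat_rcons.
by move=> s ss0; apply: (main [::]).
Qed.

Lemma pairwise_rev (T : Type) (r : rel T) s :
  pairwise r (rev s) = pairwise (fun y z => r z y) s.
Proof.
elim: s => [//|y s IH] /=.
by rewrite rev_cons pairwise_rcons IH all_rev.
Qed.

(** * Pairing the expansion with the operators B *)

Section ScalarProduct.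

Variables (F : fieldType) (Lam : Type).
Variables (am bp bm cp cm : Lam -> Lam -> F).

Local Notation Rm := (six_vertex_R am bp bm cp cm).
Local Notation ket := (ket_conf F).

Hypothesis U : unitarity Rm.
Hypothesis YB : yang_baxter Rm.

(** The monodromy lists labels decreasingly, which fits the first relation; the second fits the
    reversed chain produced by transposition. *)
Definition ltn_ord_rel N : rel 'I_N := fun i j => (i < j)%N.
Definition gtn_ord_rel N : rel 'I_N := fun i j => (j < i)%N.

Lemma right_to_left_rev_enum N : right_to_left (@ltn_ord_rel N) (rev (enum 'I_N)).
Proof.
rewrite /right_to_left pairwise_rev.
apply: sub_pairwise (pairwise_enum_ord N) => i j ij.
by rewrite /ltn_ord_rel ij -leqNgt ltnW.
Qed.

Lemma right_to_left_increasing n N (l : {ffun 'I_n -> 'I_N}) :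
  increasing l -> right_to_left (@gtn_ord_rel N) (codom l).
Proof.
move=> incl; apply: sub_pairwise (pairwise_increasing incl) => i j ij.
by rewrite /gtn_ord_rel ij -leqNgt ltnW.
Qed.

Section Sites.

Variables (N : nat) (x : 'I_N -> Lam).

Local Notation chain := (chain_block am bp bm cp cm x).
Local Notation swap := (swap_op am bp bm cp cm x).
Implicit Types (q u w r : seq 'I_N) (p i : 'I_N).

Definition ones : conf 'I_N := [ffun => e2].

(* Absorbs the factors a_- with which the operators R_{p i} act on <1|. *)
Fixpoint inversion_factor q : F :=
  if q is y :: q' then
    (\prod_(z <- q' | (y < z)%N) am (x z) (x y)) * inversion_factor q'
  else 1.

(** Only the mutual factor of [p] and [i] changes: the new [am] creates it when [i < p] and cancels
    it by unitarity when [p < i]. *)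
Lemma inversion_factor_swap u p i w : p != i ->
  inversion_factor (u ++ p :: i :: w) * am (x p) (x i) =
  inversion_factor (u ++ i :: p :: w).
Proof.
move=> pi; elim: u => [|y u IH] /=.
  rewrite !big_cons; case: (ltngtP p i) => [pi_lt|ip_lt|/val_inj pi_eq].
  - have h := am_inv U (x i) (x p).
    set A := \prod_(z <- w | _) _; set B := \prod_(z <- w | _) _.
    rewrite -[RHS]mul1r -h; ring.
  - by ring.
  - by rewrite pi_eq eqxx in pi.
rewrite -mulrA IH; congr (_ * _); apply: perm_big.
by rewrite perm_cat2l; apply/seq.permP => a /=; rewrite addnCA.
Qed.

Lemma inversion_factor_cat q1 q2 :
  inversion_factor (q1 ++ q2) = inversion_factor q1 * inversion_factor q2
    * \prod_(y <- q1) \prod_(z <- q2 | (y < z)%N) am (x z) (x y).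
Proof.
elim: q1 => [|y q1 IH] /=; first by rewrite big_nil mul1r mulr1.
by rewrite big_cat big_cons IH /=; ring.
Qed.

Lemma inversion_factor_decreasing q :
  pairwise (fun i j : 'I_N => (j < i)%N) q -> inversion_factor q = 1.
Proof.
elim: q => [//|y q IH] /= /andP[/allP yq /IH ->]; rewrite mulr1.
rewrite big_seq_cond big1 // => z /andP[/yq zy].
by rewrite ltnNge ltnW.
Qed.

Lemma constant_on_ones q : constant_on q e2 ones.
Proof. by move=> i _; rewrite ffunE. Qed.

Lemma exchangeable_bra S : uniq S ->
  exchangeable am bp bm cp cm x S (fun q => inversion_factor q *: (ket ones)^T).
Proof.
move=> uS u p i w uq'; have := uS; rewrite -(perm_uniq uq') cat_uniq.
case/and3P=> _ _ /= /andP[]; rewrite inE negb_or => /andP[pi _] _.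
rewrite -scalemxAl (@bra_swap_op _ _ _ _ _ _ _ _ _ _ _ e2) ?ffunE //.
by rewrite scalerA inversion_factor_swap.
Qed.

(** On a tail of [e2] the entry B vanishes and D is diagonal, so each B of the whole chain reduces
    to B of the head [r]. *)
Lemma chainB_prod_cat n (mu : 'I_n -> Lam) r q t :
  uniq (r ++ q) -> constant_on q e2 t ->
  (\prod_(m < n) chain (r ++ q) (mu m) e1 e2) *m ket t =
  (\prod_(m < n) \prod_(p <- q) am (mu m) (x p))
    *: ((\prod_(m < n) chain r (mu m) e1 e2) *m ket t).
Proof.
move=> urq tq; have := urq; rewrite cat_uniq => /and3P[_ qr uq].
have comm m (nu : 'I_m -> Lam) mu' a b :
    chain q mu' a b *m (\prod_(k < m) chain r (nu k) e1 e2) =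
    (\prod_(k < m) chain r (nu k) e1 e2) *m chain q mu' a b.
  elim: m nu => [|m IH] nu; first by rewrite !big_ord0 -idmxE mulmx1 mul1mx.
  rewrite big_ord_recl -mulmxE mulmxA (chain_comm _ _ _ _ _ _ _ _ _ _ _ _ qr).
  by rewrite -mulmxA IH mulmxA.
elim: n mu => [|n IH] mu; first by rewrite !big_ord0 scale1r.
have ones_q := chainB_ket_ones am bp bm cp cm x (mu ord0) uq tq.
rewrite !big_ord_recl -!mulmxE -!mulmxA IH -scalemxAr chain_block_cat sum_I2.
rewrite mulmxDl -!mulmxA ![chain q _ _ _ *m (_ *m _)]mulmxA !comm -!mulmxA.
by rewrite !ones_q !mulmx0 add0r -!scalemxAr scalerA mulrC.
Qed.

End Sites.

(** The common shape of the two partition functions: [c] is [cm] for [ZC] and [cp] for [ZB]. *)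
Definition dw_sum (c : Lam -> Lam -> F) n (nu : 'I_n -> Lam) N (x : 'I_N -> Lam)
    (lt : rel 'I_N) (l : {ffun 'I_n -> 'I_N}) : F :=
  \sum_(s : 'S_n) dw_weight am bm c x lt nu (ffun_perm l s).

(** Transposed, the operators B become operators C of the weights with [cp] and [cm] exchanged, on
    the reversed chain, where [domain_wall_expansion] applies. *)
Lemma chainB_expectation n (mu : 'I_n -> Lam) N (x : 'I_N -> Lam)
    (l : {ffun 'I_n -> 'I_N}) :
  (forall i j, i != j -> bm (x i) (x j) != 0) -> increasing l ->
  ((ket (ones N))^T *m
     (\prod_(m < n) chain_block am bp bm cp cm x (rev (codom l)) (mu m) e1 e2)
     *m ket (lower l (ones N))) 0 0
  = dw_sum cp mu x (@gtn_ord_rel N) l.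
Proof.
have tr00 (A : 'M[F]_1) : A 0 0 = A^T 0 0 by rewrite mxE.
move=> bm_neq0 incl; rewrite tr00 !trmx_mul !trmxK trmx_prod mulmxA.
under eq_bigr => k _ do rewrite trmx_chain_block revK.
have ul : uniq (codom l) by apply/uniq_codomP/increasing_inj.
rewrite (@domain_wall_expansion _ _ am bp bm cm cp _ x (unitarity_trmx U)
  (yang_baxter_trmx YB) bm_neq0 (@gtn_ord_rel N)) //.
- by rewrite (sum_injective_in _ (increasing_inj incl)).
- by rewrite size_codom card_ord.
- exact: right_to_left_increasing.
- by move=> p pl; rewrite ffunE pl.
- exact: constant_on_ones.
- by move=> p /negPf pl; rewrite [RHS]ffunE pl.
Qed.

Lemma expectation_chains N a b (A : op_on F 'I_N) :
  expectation a A b = ((ket [ffun => a])^T *m A *m ket [ffun => b]) 0 0.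
Proof. by []. Qed.

Lemma scalar_product_expansion L M (xi : 'I_L -> Lam) (mu nu : 'I_M -> Lam) :
  (forall i j, i != j -> bm (xi i) (xi j) != 0) ->
  scalar_product Rm xi mu nu =
  \sum_(l : {ffun 'I_M -> 'I_L} | increasing l)
    (\prod_(m < M) \prod_(p < L | p \notin codom l)
       (am (mu m) (xi p) * am (nu m) (xi p)
         / (bm (xi p) (xi (l m)) * am (xi (l m)) (xi p))))
    * dw_sum cm nu xi (@ltn_ord_rel L) l * dw_sum cp mu xi (@gtn_ord_rel L) l.
Proof.
move=> bm_neq0; rewrite /scalar_product expectation_chains -mulmxE mulmxA.
under [X in _ *m X *m _ *m _]eq_bigr => k _ do rewrite /opB aux_block_monodromy.
under [X in _ *m X *m _]eq_bigr => k _ do rewrite /opC aux_block_monodromy.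
set S := rev (enum 'I_L).
have uS : uniq S by rewrite rev_uniq enum_uniq.
have ST p : p \in S by rewrite mem_rev mem_enum.
pose Y q := (inversion_factor xi q *: (ket (ones L))^T)
   *m \prod_(m < M) chain_block am bp bm cp cm xi q (mu m) e1 e2.
have exY : exchangeable am bp bm cp cm xi S Y.
  by apply: exchangeable_prod => //; apply: exchangeable_bra.
have SE : inversion_factor xi S = 1.
  apply: inversion_factor_decreasing; rewrite pairwise_rev.
  exact: pairwise_enum_ord.
have nil_e1 : constant_on [::] e1 (ones L) by [].
transitivity ((Y S *m (\prod_(k < M)
     chain_block am bp bm cp cm xi S (nu (rev_ord k)) e2 e1)
   *m ket (ones L)) 0 0).
  by rewrite /Y SE scale1r.
rewrite [LHS](@expansion _ _ _ _ _ _ _ _ _ YB (@ltn_ord_rel L) U bm_neq0 M nu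
  _ _ [::] S _ exY uS (perm_refl S) (right_to_left_rev_enum L) nil_e1
  (@constant_on_ones L S)).
rewrite sum_injective //; apply: eq_bigr => l incl.
have ul : uniq (codom l) by apply/uniq_codomP/increasing_inj.
pose rest := [seq p <- S | p \notin codom l].
have restE (s : 'S_M) : [seq p <- S | p \notin codom (ffun_perm l s)] = rest.
  by apply: eq_filter => p; rewrite codom_ffun_perm.
have lowerE (s : 'S_M) : lower (ffun_perm l s) (ones L) = lower l (ones L).
  by apply/ffunP => p; rewrite !ffunE codom_ffun_perm.
have perm_rest r : perm_eq r (codom l) -> perm_eq (r ++ rest) S.
  move=> rl; apply: uniq_perm => //.
    rewrite cat_uniq (perm_uniq rl) ul filter_uniq // andbT /=.
    by apply/hasPn => p; rewrite mem_filter -(perm_mem rl) => /andP[].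
  by move=> p; rewrite mem_cat mem_filter (perm_mem rl) ST andbT orbN.
(* R fixes pairs of chosen sites, now all in state [e1], so their order may be changed at will; the
   decreasing one is taken. *)
have tail s : (Y (codom (ffun_perm l s) ++ rest) *m ket (lower l (ones L))) 0 0
    = (Y (rev (codom l) ++ rest) *m ket (lower l (ones L))) 0 0.
  pose f r := (Y (r ++ rest) *m ket (lower l (ones L))) 0 0.
  apply: (@perm_invariant _ _ f) => [u p i w upiw|].
    rewrite /f -!catA /= -(exY u p i (w ++ rest)); last first.
      rewrite -[_ ++ _ :: _]/(u ++ (p :: i :: w) ++ rest) catA perm_rest //.
      by rewrite (perm_trans upiw) // perm_rev.
    have pl : p \in codom l.
      by rewrite -mem_rev -(perm_mem upiw) mem_cat !inE eqxx !orbT.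
    have il : i \in codom l.
      by rewrite -mem_rev -(perm_mem upiw) mem_cat !inE eqxx !orbT.
    have pi : p != i.
      have := ul; rewrite -rev_uniq -(perm_uniq upiw) cat_uniq.
      by case/and3P=> _ _ /= /andP[]; rewrite inE negb_or => /andP[].
    rewrite -mulmxA (@swap_ket_same _ _ _ _ _ _ _ _ _ p i e1) // ?scale1r //.
      by rewrite ffunE pl.
    by rewrite ffunE il.
  rewrite perm_sym perm_rev; apply: uniq_perm => //.
    apply/uniq_codomP => j k; rewrite !ffunE.
    by move/(increasing_inj incl)/perm_inj.
  by move=> p; rewrite codom_ffun_perm.
under eq_bigr => s _ do rewrite restE lowerE /= tail.
have rest_ones : constant_on rest e2 (lower l (ones L)).
  by move=> p; rewrite mem_filter !ffunE => /andP[/negPf ->].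
(* In this order [inversion_factor] keeps only pairs of a chosen site and an unchosen one. *)
have YE : (Y (rev (codom l) ++ rest) *m ket (lower l (ones L))) 0 0 =
    (\prod_(m < M) \prod_(p < L | p \notin codom l)
       ((if (l m < p)%N then am (xi p) (xi (l m)) else 1) * am (mu m) (xi p)))
    * dw_sum cp mu xi (@gtn_ord_rel L) l.
  have urest : uniq (rev (codom l) ++ rest).
    by rewrite (perm_uniq (perm_rest _ _)) // perm_rev.
  rewrite /Y -mulmxA chainB_prod_cat // -scalemxAr -!scalemxAl mulmxA.
  rewrite mxE mxE chainB_expectation // mulrA; congr (_ * _).
  rewrite inversion_factor_cat.
  rewrite [inversion_factor xi (rev _)]inversion_factor_decreasing; last first.
    by rewrite pairwise_rev; apply: pairwise_increasing.
  rewrite inversion_factor_decreasing; last first.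
    by apply: pairwise_filter; rewrite pairwise_rev; apply: pairwise_enum_ord.
  rewrite !mul1r mulrC (perm_big (codom l)) /=; last by rewrite perm_rev.
  rewrite [X in X * _](_ : _ = \prod_(m < M)
    \prod_(p <- rest | (l m < p)%N) am (xi p) (xi (l m))); last first.
    by rewrite /codom /image_mem big_map big_enum.
  rewrite -big_split; apply: eq_bigr => m _ /=.
  rewrite big_mkcond -big_split /= big_filter (perm_big (enum 'I_L)).
    by rewrite big_enum_cond.
  by rewrite perm_rev.
rewrite YE -mulr_suml.
have restP (f : 'I_L -> F) :
    \prod_(p <- S | p \notin codom l) f p = \prod_(p < L | p \notin codom l) f p.
  rewrite (perm_big (enum 'I_L)); last by rewrite perm_rev.
  by rewrite big_enum_cond.
have weightE s :
  config_weight am bm cm xi (@ltn_ord_rel L) nu [::] S (ffun_perm l s)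
  = dw_weight am bm cm xi (@ltn_ord_rel L) nu (ffun_perm l s)
    * \prod_(m < M) \prod_(p < L | p \notin codom l)
       (am (nu m) (xi p) * (order_factor am xi (@ltn_ord_rel L) p (l m)
          / bm (xi p) (xi (l m)))).
  rewrite /config_weight /dw_weight.
  rewrite [X in _ * X * _ * _]big1 ?mulr1; last by move=> k _; rewrite big_nil.
  congr (_ * _).
  (* Once [am (nu k)] is split off, the other factors depend on [k] only through the chosen site, so
     reindexing removes the permutation. *)
  transitivity ((\prod_(k < M) \prod_(p < L | p \notin codom l) am (nu k) (xi p))
    * \prod_(k < M) \prod_(p < L | p \notin codom l)
       (order_factor am xi (@ltn_ord_rel L) p (l (s k))
          / bm (xi p) (xi (l (s k))))).
    rewrite -big_split; apply: eq_bigr => k _ /=.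
    rewrite -big_split /= -restP; apply: eq_big => p.
      by rewrite codom_ffun_perm.
    by move=> _; rewrite /rest_weight ffunE; ring.
  rewrite [X in _ * X](reindex_inj (@perm_inj _ s^-1)) /=.
  rewrite -big_split; apply: eq_bigr => k _ /=.
  by rewrite -big_split; apply: eq_bigr => p _; rewrite permKV.
under eq_bigr => s _ do rewrite weightE.
rewrite -mulr_suml mulrA; congr (_ * _).
rewrite -mulrA [RHS]mulrC; congr (_ * _).
rewrite -big_split; apply: eq_bigr => m _ /=.
rewrite -big_split; apply: eq_bigr => p pl /=.
have a0 : am (xi (l m)) (xi p) != 0 by apply: am_neq0 U _ _.
(* The order factor covers [p < l m] and the inversion factor [l m < p]; together they give the
   denominator [am (xi (l m)) (xi p)] for every unchosen [p]. *)
have aV : am (xi p) (xi (l m)) = (am (xi (l m)) (xi p))^-1.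
  by apply: (mulIf a0); rewrite mulVf // (am_inv U).
rewrite invfM -aV /order_factor /ltn_ord_rel.
case: (ltngtP p (l m)) => [_|_|/val_inj pE]; try by ring.
by rewrite pE codom_f in pl.
Qed.

End ScalarProduct.

(** * Explicit sums for the partition functions *)

Section PartitionFunctions.

Variables (F : fieldType) (Lam : Type).
Variables (am bp bm cp cm : Lam -> Lam -> F).

Local Notation Rm := (six_vertex_R am bp bm cp cm).

Hypothesis U : unitarity Rm.
Hypothesis YB : yang_baxter Rm.

(** Identifies the selected sites, taken as a chain of their own with labels in ['I_M], with the
    same sites inside the long chain. *)
Lemma dw_sum_comp (c : Lam -> Lam -> F) M L (nu : 'I_M -> Lam)
    (xi : 'I_L -> Lam) (l : {ffun 'I_M -> 'I_L}) lt lt' :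
  (forall i j, lt i j = lt' (l i) (l j)) ->
  dw_sum am bm c nu (xi \o l) lt (finfun id) = dw_sum am bm c nu xi lt' l.
Proof.
move=> ltE; apply: eq_bigr => s _; rewrite /dw_weight.
congr (_ * _); first by apply: eq_bigr => k _; rewrite !ffunE.
apply: eq_bigr => j _; apply: eq_bigr => k _.
by rewrite /pair_weight /order_factor /= !ffunE ltE.
Qed.

Section Sites.

Variables (M : nat) (y : 'I_M -> Lam).
Hypothesis bm_neq0 : forall i j, i != j -> bm (y i) (y j) != 0.

Let idf : {ffun 'I_M -> 'I_M} := finfun id.

Let idf_inj : injective idf.
Proof. by move=> i j; rewrite !ffunE. Qed.

Let codom_idf : codom idf = enum 'I_M.
Proof.
by rewrite /codom /image_mem -[RHS]map_id; apply: eq_map => i; rewrite ffunE.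
Qed.

Lemma ZC_expansion (nu : 'I_M -> Lam) :
  ZC Rm nu y = dw_sum am bm cm nu y (@ltn_ord_rel M) idf.
Proof.
rewrite /ZC expectation_chains.
under [X in _ *m X *m _]eq_bigr => k _ do rewrite /opC aux_block_monodromy.
rewrite (@domain_wall_expansion _ _ _ _ _ _ _ _ _ U YB bm_neq0 (@ltn_ord_rel M)).
- by apply: sum_injective_in => // p; rewrite codom_idf mem_rev.
- by rewrite rev_uniq enum_uniq.
- by rewrite size_rev size_enum_ord.
- exact: right_to_left_rev_enum.
- by move=> i _; rewrite ffunE.
- by move=> i _; rewrite ffunE.
- by move=> p; rewrite mem_rev mem_enum.
Qed.

Lemma ZB_expansion (mu : 'I_M -> Lam) :
  ZB Rm mu y = dw_sum am bm cp mu y (@gtn_ord_rel M) idf.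
Proof.
have inc_id : increasing idf by apply/increasingP => i j; rewrite !ffunE.
rewrite -(chainB_expectation U YB mu bm_neq0 inc_id) codom_idf.
rewrite /ZB expectation_chains.
under [X in _ *m X *m _]eq_bigr => k _ do rewrite /opB aux_block_monodromy.
congr (fun_of_matrix (_ *m _ *m ket_conf _ _) _ _).
by apply/ffunP => p; rewrite !ffunE codom_idf mem_enum.
Qed.

End Sites.

End PartitionFunctions.

(** * The factorised and the explicit formula for the scalar product *)

Theorem mainTheorem3 (R : realType) (Lam : Type)
    (am bp bm cp cm : Lam -> Lam -> R[i])
    (R_unitary : unitarity (six_vertex_R am bp bm cp cm))
    (R_yang_baxter : yang_baxter (six_vertex_R am bp bm cp cm))
    (L M : nat) (M_bounds : (1 <= M <= L)%N)
    (xi : 'I_L -> Lam) (mu nu : 'I_M -> Lam)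
    (bm_neq0 : forall i j : 'I_L, i != j -> bm (xi i) (xi j) != 0) :
  let Rm := six_vertex_R am bp bm cp cm in
  scalar_product Rm xi mu nu
  = \sum_(l : {ffun 'I_M -> 'I_L} | increasing l)
      (\prod_(m < M) \prod_(p < L | p \notin codom l)
         (am (mu m) (xi p) * am (nu m) (xi p)
          / (bm (xi p) (xi (l m)) * am (xi (l m)) (xi p))))
      * ZC Rm nu (xi \o l) * ZB Rm mu (xi \o l)
  /\
  scalar_product Rm xi mu nu
  = \sum_(l : {ffun 'I_M -> 'I_L} | increasing l)
    \sum_(sigma : 'S_M) \sum_(tau : 'S_M)
      (\prod_(m < M) \prod_(p < L | p \notin codom l)
         (am (mu m) (xi p) * am (nu m) (xi p)
          / (bm (xi p) (xi (l m)) * am (xi (l m)) (xi p))))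
      * (\prod_(i < M)
           (cm (nu i) (xi (l (sigma i))) * cp (mu i) (xi (l (tau i)))))
      * (\prod_(j < M) \prod_(k < M | (j < k)%N)
           (theta am xi (l (sigma k)) (l (sigma j))
            / theta am xi (l (tau j)) (l (tau k))
            * (bm (nu k) (xi (l (sigma j))) * bm (mu k) (xi (l (tau j)))
               * am (nu j) (xi (l (sigma k))) * am (mu j) (xi (l (tau k)))
               / (bm (xi (l (sigma k))) (xi (l (sigma j)))
                  * bm (xi (l (tau k))) (xi (l (tau j))))))).
Proof.
have S_exp := scalar_product_expansion R_unitary R_yang_baxter mu nu bm_neq0.
split.
  rewrite S_exp; apply: eq_bigr => l incl; rewrite -!mulrA; congr (_ * _).
  have bm_l (i j : 'I_M) : i != j -> bm ((xi \o l) i) ((xi \o l) j) != 0.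
    by move=> ij; apply: bm_neq0; rewrite (inj_eq (increasing_inj incl)).
  rewrite (ZC_expansion R_unitary R_yang_baxter bm_l).
  rewrite (ZB_expansion R_unitary R_yang_baxter bm_l).
  rewrite (@dw_sum_comp _ _ _ _ _ _ _ _ _ _ _ (@ltn_ord_rel L)); last first.
    by move=> i j; rewrite /ltn_ord_rel increasing_ltn.
  rewrite (@dw_sum_comp _ _ _ _ _ _ _ _ _ _ _ (@gtn_ord_rel L)) //.
  by move=> i j; rewrite /gtn_ord_rel increasing_ltn.
rewrite S_exp; apply: eq_bigr => l incl; rewrite -mulrA mulr_suml mulr_sumr.
apply: eq_bigr => s _; rewrite !mulr_sumr; apply: eq_bigr => t _.
rewrite -[RHS]mulrA; congr (_ * _); rewrite /dw_weight mulrACA -!big_split /=.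
apply: eq_bigr => j _; rewrite -big_split !ffunE; congr (_ * _).
apply: eq_bigr => k _ /=.
rewrite /pair_weight /order_factor /theta /ltn_ord_rel /gtn_ord_rel !ffunE.
(* The [theta] in the denominator comes from the order factor of the reversed chain, inverted by
   unitarity. *)
have am_V : am (xi (l (t k))) (xi (l (t j))) =
    (am (xi (l (t j))) (xi (l (t k))))^-1.
  have a0 := am_neq0 R_unitary (xi (l (t j))) (xi (l (t k))).
  by apply: (mulIf a0); rewrite mulVf // (am_inv R_unitary).
rewrite am_V invfM; case: ifP => _; case: ifP => _; rewrite ?invr1; ring.
Qed.
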